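(* There is, up to isomorphism, a unique noncommutative and noncocommutative Hopf algebra over $\mathbb{F}_2$ of dimension $4$. It is given on a basis $1,s,x,w$ (with $1$ the unit) by \[ s^2=1,\quad sx=wx=w^2=w,\quad xs=1+s+w,\quad ws=1+s+x,\quad sw=xw=x^2=x,\] \[ \Delta s=s\otimes s,\quad \Delta x=s\otimes x+x\otimes 1,\quad \Delta w=1\otimes w+w\otimes s,\quad \epsilon(s)=1,\quad \epsilon(x)=\epsilon(w)=0,\] \[ Ss=s,\quad Sx=w,\quad Sw=1+s+x.\] It is of type $(NF,NF^* )$ and is self-dual with duality pairing \[ \langle1,1\rangle=\langle1,s\rangle=\langle s,1\rangle=\langle s,s\rangle=\langle s,x\rangle=\langle s,w\rangle=\langle x,s\rangle=\langle w,s\rangle=\langle w,w\rangle=1\] and all other pairings of elements of this basis equal to zero.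
   Context: $NF$ denotes the $4$-dimensional unital $\mathbb{F}_2$-algebra with basis $1,x,y,z$ in which all products of $x,y,z$ are zero except $x^2=x$, $yx=y$, $xz=z$. A bialgebra $H$ is of type $(NF,NF^* )$ if $H\cong NF$ as an algebra and $H$ is isomorphic as a coalgebra to the dual coalgebra of $NF$ (equivalently the dual algebra $H^*$ is isomorphic to $NF$). Noncocommutative means $\Delta$ is not equal to its composite with the flip. A self-duality pairing on $H$ is a nondegenerate bilinear form $\langle\ ,\ \rangle:H\otimes H\to\mathbb{F}_2$ with $\langle ab,c\rangle=\langle a\otimes b,\Delta c\rangle$, $\langle a,bc\rangle=\langle\Delta a,b\otimes c\rangle$, $\langle1,a\rangle=\epsilon(a)=\langle a,1\rangle$, where $\langle a\otimes b,c\otimes d\rangle=\langle a,c\rangle\langle b,d\rangle$ (compatibility with antipodes $\langle Sa,b\rangle=\langle a,Sb\rangle$ is then automatic). $H$ is self-dual if such a form exists. *)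

(* Defs.v *)
From HB Require Import structures.
From mathcomp Require Import all_boot all_order all_algebra all_field.
From mathcomp Require Import ring.

Set Implicit Arguments.
Unset Strict Implicit.
Unset Printing Implicit Defensive.

Import GRing.Theory VectorInternalTheory.

Local Open Scope ring_scope.

Section Coordinates.

Variables (F : fieldType) (V : vectType F).

Definition vbase (i : 'I_(dim V)) : V := r2v (delta_mx 0 i).

Definition vcoord (i : 'I_(dim V)) (v : V) : F := v2r v 0 i.

Lemma vcoord_linear i : linear (vcoord i : V -> F^o).
Proof. by move=> a u v; rewrite /vcoord linearP !mxE. Qed.

Lemma vcoord_vbase i j : vcoord i (vbase j) = (i == j)%:R.
Proof. by rewrite /vcoord r2vK mxE. Qed.

Lemma vcoord_sum v : v = \sum_i vcoord i v *: vbase i.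
Proof.
rewrite -[v in LHS]v2rK [v2r v in LHS]row_sum_delta linear_sum /=.
by apply: eq_bigr => i _; rewrite linearZ.
Qed.

End Coordinates.

(* The tensor product of two finite dimensional spaces: the element           *)
(* \sum_(i, j) t i j (e_i (x) e_j), for (e_i) and (e_j) the reference bases   *)
(* vbase of U and V, is the matrix t. By tlift_tens and tlift_unique this has *)
(* the universal property of the tensor product, so that nothing below        *)
(* depends on the choice of these bases.                                      *)
Definition tensor (F : fieldType) (U V : vectType F) : Type :=
  'M[F]_(dim U, dim V).

HB.instance Definition _ (F : fieldType) (U V : vectType F) :=
  Vector.on (tensor U V).

Section Tensor.

Variable F : fieldType.

Definition tens (U V : vectType F) (u : U) (v : V) : tensor U V :=
  (v2r u)^T *m v2r v.

Definition tlift (U V : vectType F) (W : lmodType F) (f : U -> V -> W)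
    (t : tensor U V) : W :=
  \sum_i \sum_j t i j *: f (vbase i) (vbase j).

Lemma tensE (U V : vectType F) (u : U) (v : V) i j :
  tens u v i j = vcoord i u * vcoord j v.
Proof. by rewrite mxE big_ord1 mxE. Qed.

Lemma tens_linearl (U V : vectType F) (v : V) :
  linear (fun u : U => tens u v).
Proof. by move=> a u u'; rewrite /tens 2!linearP /= mulmxDl scalemxAl. Qed.

Lemma tens_linearr (U V : vectType F) (u : U) : linear (@tens U V u).
Proof. by move=> a v v'; rewrite /tens linearP /= mulmxDr scalemxAr. Qed.

Lemma tlift_is_linear (U V : vectType F) (W : lmodType F) (f : U -> V -> W) :
  linear (tlift f).
Proof.
move=> a t t'; rewrite /tlift scaler_sumr -big_split /=; apply: eq_bigr => i _.
rewrite scaler_sumr -big_split /=; apply: eq_bigr => j _.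
by rewrite scalerA -scalerDl !mxE.
Qed.

HB.instance Definition _ (U V : vectType F) (W : lmodType F) (f : U -> V -> W) :=
  GRing.isLinear.Build F (tensor U V) W _ (tlift f) (tlift_is_linear f).

Lemma linear_sum_vcoord (V : vectType F) (W : lmodType F) (f : V -> W) v :
  linear f -> f v = \sum_i vcoord i v *: f (vbase i).
Proof.
move=> fL.
have fD := zmod_morphism_linear fL; have fZ := scalable_linear fL.
have f0 : f 0 = 0 by rewrite -[X in f X](subrr 0) fD subrr.
have fN u : f (- u) = - f u by rewrite -[- u]sub0r fD f0 sub0r.
have fA u w : f (u + w) = f u + f w by rewrite -{1}[w]opprK fD fN opprK.
rewrite {1}(vcoord_sum v) (big_morph f fA f0).
by apply: eq_bigr => i _; rewrite fZ.
Qed.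

Lemma tlift_tens (U V : vectType F) (W : lmodType F) (f : U -> V -> W) :
  (forall v, linear (f^~ v)) -> (forall u, linear (f u)) ->
  forall u v, tlift f (tens u v) = f u v.
Proof.
move=> fl fr u v; rewrite (linear_sum_vcoord u (fl v)) /tlift.
apply: eq_bigr => i _; rewrite (linear_sum_vcoord v (fr _)) scaler_sumr.
by apply: eq_bigr => j _; rewrite tensE scalerA.
Qed.

Lemma tlift_tens_id (U V : vectType F) (t : tensor U V) :
  tlift (@tens U V) t = t.
Proof.
rewrite [RHS](matrix_sum_delta t); apply: eq_bigr => i _; apply: eq_bigr => j _.
congr (_ *: _); apply/matrixP => k l; rewrite tensE !vcoord_vbase mxE.
by rewrite -mulnb natrM.
Qed.

Lemma tlift_unique (U V : vectType F) (W : lmodType F)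
    (g : {linear tensor U V -> W}) (f : U -> V -> W) :
  (forall u v, g (tens u v) = f u v) -> forall t, g t = tlift f t.
Proof.
move=> gE t; rewrite -{1}(tlift_tens_id t) !linear_sum.
apply: eq_bigr => i _; rewrite linear_sum; apply: eq_bigr => j _.
by rewrite linearZ /= gE.
Qed.

Definition tmap (U V U' V' : vectType F) (f : U -> U') (g : V -> V') :
    tensor U V -> tensor U' V' :=
  tlift (fun u v => tens (f u) (g v)).

Definition tswap (U V : vectType F) : tensor U V -> tensor V U :=
  tlift (fun u v => tens v u).

Definition tassoc (U V W : vectType F) :
    tensor (tensor U V) W -> tensor U (tensor V W) :=
  tlift (fun t w => tlift (fun u v => tens u (tens v w)) t).

Definition tmul (A B : falgType F) (t t' : tensor A B) : tensor A B :=
  tlift (fun a b => tlift (fun c d => tens (a * c) (b * d)) t') t.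

Lemma tlift_fun_linear (U V : vectType F) (W : lmodType F)
    (f g : U -> V -> W) k t :
  tlift (fun u v => k *: f u v + g u v) t = k *: tlift f t + tlift g t.
Proof.
rewrite /tlift scaler_sumr -big_split; apply: eq_bigr => i _ /=.
rewrite scaler_sumr -big_split; apply: eq_bigr => j _ /=.
by rewrite scalerDr !scalerA mulrC.
Qed.

Lemma eq_tlift (U V : vectType F) (W : lmodType F) (f g : U -> V -> W) :
  f =2 g -> tlift f =1 tlift g.
Proof.
by move=> fg t; apply: eq_bigr => i _; apply: eq_bigr => j _; rewrite fg.
Qed.

Lemma tmap_is_linear (U V U' V' : vectType F) (f : U -> U') (g : V -> V') :
  linear (tmap f g).
Proof. exact: tlift_is_linear. Qed.

HB.instance Definition _ (U V U' V' : vectType F) (f : U -> U') (g : V -> V') :=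
  GRing.isLinear.Build F (tensor U V) (tensor U' V') _ (tmap f g)
    (tmap_is_linear f g).

Lemma tmap_tens (U V U' V' : vectType F)
    (f : {linear U -> U'}) (g : {linear V -> V'}) u v :
  tmap f g (tens u v) = tens (f u) (g v).
Proof.
rewrite /tmap tlift_tens // => w k x y /=.
  by rewrite linearP tens_linearl.
by rewrite linearP tens_linearr.
Qed.

Lemma tswap_tens (U V : vectType F) (u : U) (v : V) :
  tswap (tens u v) = tens v u.
Proof.
by rewrite /tswap tlift_tens // => w; [apply: tens_linearr | apply: tens_linearl].
Qed.

Lemma tassoc_is_linear (U V W : vectType F) : linear (@tassoc U V W).
Proof. exact: tlift_is_linear. Qed.

HB.instance Definition _ (U V W : vectType F) :=
  GRing.isLinear.Build F (tensor (tensor U V) W) (tensor U (tensor V W)) _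
    (@tassoc U V W) (@tassoc_is_linear U V W).

Lemma tassoc_tens (U V W : vectType F) (u : U) (v : V) (w : W) :
  tassoc (tens (tens u v) w) = tens u (tens v w).
Proof.
rewrite /tassoc tlift_tens.
- rewrite tlift_tens // => [y | x] k z z' /=.
  + by rewrite tens_linearl.
  + by rewrite tens_linearl tens_linearr.
- exact: (fun=> @tlift_is_linear _ _ _ _).
- move=> t k z z' /=; rewrite -tlift_fun_linear; apply: eq_tlift => x y.
  by rewrite !tens_linearr.
Qed.

Lemma tmul_tens (A B : falgType F) (a c : A) (b d : B) :
  tmul (tens a b) (tens c d) = tens (a * c) (b * d).
Proof.
rewrite /tmul tlift_tens.
- rewrite tlift_tens // => [y k x x' | x k y y'].
  + by rewrite mulrDr -scalerAr tens_linearl.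
  + by rewrite mulrDr -scalerAr tens_linearr.
- move=> y k x x' /=; rewrite -tlift_fun_linear; apply: eq_tlift => z z'.
  by rewrite mulrDl -scalerAl tens_linearl.
- move=> x k y y' /=; rewrite -tlift_fun_linear; apply: eq_tlift => z z'.
  by rewrite mulrDl -scalerAl tens_linearr.
Qed.

End Tensor.

HB.mixin Record Vector_isCoalgebra (F : fieldType) C of Vector F C := {
  comul : {linear C -> tensor C C};
  counit : {scalar C};
  comulA : forall c, tassoc (tmap comul idfun (comul c)) =
                     tmap idfun comul (comul c);
  counitl : forall c, tlift (fun a b => counit a *: b) (comul c) = c;
  counitr : forall c, tlift (fun a b => counit b *: a) (comul c) = c
}.

#[short(type="coalgType")]
HB.structure Definition Coalgebra (F : fieldType) :=
  { C of Vector F C & Vector_isCoalgebra F C }.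

HB.mixin Record Coalgebra_isBialgebra (F : fieldType) H
    of Falgebra F H & Coalgebra F H := {
  comul1 : comul (1 : H) = tens 1 1;
  comulM : forall a b : H, comul (a * b) = tmul (comul a) (comul b);
  counit1 : counit (1 : H) = 1;
  counitM : forall a b : H, counit (a * b) = counit a * counit b
}.

#[short(type="bialgType")]
HB.structure Definition Bialgebra (F : fieldType) :=
  { H of Falgebra F H & Coalgebra F H & Coalgebra_isBialgebra F H }.

HB.mixin Record Bialgebra_isHopf (F : fieldType) H of Bialgebra F H := {
  antipode : {linear H -> H};
  antipodel : forall a : H,
    tlift (fun b c => antipode b * c) (comul a) = (counit a)%:A;
  antipoder : forall a : H,
    tlift (fun b c => b * antipode c) (comul a) = (counit a)%:A
}.

#[short(type="hopfAlgType")]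
HB.structure Definition HopfAlgebra (F : fieldType) :=
  { H of Bialgebra F H & Bialgebra_isHopf F H }.

Definition noncommutative (F : fieldType) (A : falgType F) : Prop :=
  ~ commutative (@GRing.mul A).

Definition noncocommutative (F : fieldType) (C : coalgType F) : Prop :=
  ~ (forall c : C, tswap (comul c) = comul c).

Definition alg_isom (F : fieldType) (A B : falgType F) : Prop :=
  exists f : {lrmorphism A -> B}, bijective f.

Definition coalg_isom (F : fieldType) (C D : coalgType F) : Prop :=
  exists f : {linear C -> D},
    [/\ bijective f,
        forall c, comul (f c) = tmap f f (comul c)
      & forall c, counit (f c) = counit c].

Definition hopf_isom (F : fieldType) (H K : hopfAlgType F) : Prop :=
  exists f : {lrmorphism H -> K},
    [/\ bijective f,
        forall a, comul (f a) = tmap f f (comul a),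
        forall a, counit (f a) = counit a
      & forall a, f (antipode a) = antipode (f a)].

(* The coalgebra dual to a finite dimensional algebra. *)
Definition dual (F : fieldType) (A : falgType F) : Type := 'Hom(A, F^o).

HB.instance Definition _ (F : fieldType) (A : falgType F) :=
  Vector.on (dual A).

Section DualCoalgebra.

Variables (F : fieldType) (A : falgType F).

Definition dual_vbase (i : 'I_(dim A)) : dual A :=
  linfun (vcoord i : A -> F^o).

(* The transpose of the product of A; see dual_comulE. *)
Definition dual_comul (f : dual A) : tensor (dual A) (dual A) :=
  \sum_i \sum_j
    (f (vbase i * vbase j) : F) *: tens (dual_vbase i) (dual_vbase j).

Definition dual_counit (f : dual A) : F := f 1.

Lemma dual_vbaseE i v : dual_vbase i v = vcoord i v.
Proof.
rewrite /dual_vbase.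
pose g : {linear A -> F^o} :=
  HB.pack (vcoord i : A -> F^o)
    (GRing.isLinear.Build F A F^o _ (vcoord i : A -> F^o) (vcoord_linear i)).
exact: (lfunE g v).
Qed.

Lemma dual_sum (f : dual A) : f = \sum_i (f (vbase i) : F) *: dual_vbase i.
Proof.
apply/lfunP => v; rewrite {1}(vcoord_sum v) linear_sum sum_lfunE /=.
apply: eq_bigr => i _.
by rewrite linearZ /= lfunE /= dual_vbaseE /GRing.scale /= mulrC.
Qed.

Lemma dual_comul_is_linear : linear dual_comul.
Proof.
move=> k f g; rewrite /dual_comul scaler_sumr -big_split.
apply: eq_bigr => i _; rewrite scaler_sumr -big_split; apply: eq_bigr => j _ /=.
by rewrite add_lfunE scale_lfunE scalerDl scalerA.
Qed.

HB.instance Definition _ :=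
  GRing.isLinear.Build F (dual A) (tensor (dual A) (dual A)) _ dual_comul
    dual_comul_is_linear.

Lemma dual_counit_is_linear : linear_for *%R dual_counit.
Proof. by move=> k f g; rewrite /dual_counit add_lfunE scale_lfunE. Qed.

HB.instance Definition _ :=
  GRing.isLinear.Build F (dual A) F _ dual_counit dual_counit_is_linear.

Lemma dual_comulE (f : dual A) (a b : A) :
  tlift (fun g h : dual A => (g a : F^o) * h b) (dual_comul f) = f (a * b).
Proof.
rewrite linear_sum {2}(vcoord_sum a) mulr_suml linear_sum.
apply: eq_bigr => i _; rewrite linear_sum {2}(vcoord_sum b) mulr_sumr linear_sum.
apply: eq_bigr => j _; rewrite linearZ /= tlift_tens; first last.
- by move=> g k h h'; rewrite add_lfunE scale_lfunE mulrDr -scalerAr.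
- by move=> g k h h'; rewrite add_lfunE scale_lfunE mulrDl -scalerAl.
rewrite !dual_vbaseE -scalerAl -scalerAr !linearZ /= /GRing.scale /=.
by rewrite [f _ * _]mulrC.
Qed.

Lemma dual_comulA f :
  tassoc (tmap dual_comul idfun (dual_comul f)) =
  tmap idfun dual_comul (dual_comul f).
Proof.
pose fr b : dual A := linfun (f \o (b \o* idfun)).
pose fl b : dual A := linfun (f \o (b \*o idfun)).
have frE b a : fr b a = f (a * b) by apply: (lfunE (f \o (b \o* idfun))).
have flE b a : fl b a = f (b * a) by apply: (lfunE (f \o (b \*o idfun))).
pose e i : dual A := dual_vbase i.
pose T k l m : tensor (dual A) (tensor (dual A) (dual A)) :=
  tens (e k) (tens (e l) (e m)).
have tensZl (U V : vectType F) k (u : U) (v : V) :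
    k *: tens u v = tens (k *: u) v.
  by rewrite /tens linearZ /= linearZ /= scalemxAl.
have tensZr (U V : vectType F) k (u : U) (v : V) :
    k *: tens u v = tens u (k *: v).
  by rewrite /tens linearZ /= scalemxAr.
have tensDl (U V : vectType F) I r (P : pred I) (G : I -> U) (v : V) :
    \sum_(i <- r | P i) tens (G i) v = tens (\sum_(i <- r | P i) G i) v.
  by rewrite /tens !linear_sum mulmx_suml.
have tensDr (U V : vectType F) I r (P : pred I) (G : I -> V) (u : U) :
    \sum_(i <- r | P i) tens u (G i) = tens u (\sum_(i <- r | P i) G i).
  by rewrite /tens linear_sum mulmx_sumr.
have -> : tassoc (tmap dual_comul idfun (dual_comul f)) =
    \sum_m \sum_k \sum_l (f (vbase k * vbase l * vbase m) : F) *: T k l m.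
  rewrite [dual_comul f]/dual_comul exchange_big /=.
  rewrite [tmap _ _ _]linear_sum [LHS]linear_sum /=; apply: eq_bigr => m _.
  rewrite [tmap _ _ _]linear_sum [LHS]linear_sum /=.
  under eq_bigr => i _ do rewrite !linearZ /= tmap_tens -linearZ /= tensZl -linearZ.
  rewrite -linear_sum tensDl -linear_sum /=.
  have -> : \sum_i (f (vbase i * vbase m) : F) *: dual_vbase i = fr (vbase m).
    by rewrite [RHS]dual_sum; apply: eq_bigr => i _; rewrite frE.
  rewrite /dual_comul -tensDl linear_sum; apply: eq_bigr => k _.
  rewrite -tensDl linear_sum; apply: eq_bigr => l _.
  by rewrite -tensZl linearZ /= tassoc_tens frE.
have -> : tmap idfun dual_comul (dual_comul f) =
    \sum_k \sum_l \sum_m (f (vbase k * vbase l * vbase m) : F) *: T k l m.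
  rewrite [dual_comul f]/dual_comul [LHS]linear_sum /=; apply: eq_bigr => k _.
  rewrite [LHS]linear_sum /=.
  under eq_bigr => i _ do rewrite linearZ /= tmap_tens tensZr -linearZ.
  rewrite tensDr -linear_sum /=.
  have -> : \sum_i (f (vbase k * vbase i) : F) *: dual_vbase i = fl (vbase k).
    by rewrite [RHS]dual_sum; apply: eq_bigr => i _; rewrite flE.
  rewrite /dual_comul -tensDr; apply: eq_bigr => l _.
  rewrite -tensDr; apply: eq_bigr => m _.
  by rewrite -tensZr flE /= mulrA.
rewrite exchange_big; apply: eq_bigr => k _; exact: exchange_big.
Qed.

Lemma dual_counitl f :
  tlift (fun g h => dual_counit g *: h) (dual_comul f) = f.
Proof.
rewrite /dual_comul exchange_big linear_sum [RHS]dual_sum.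
apply: eq_bigr => j _; rewrite linear_sum /=.
under eq_bigr => i _.
  rewrite linearZ /= tlift_tens; first last.
  - by move=> g k h h'; rewrite scalerDr !scalerA mulrC.
  - by move=> g k h h'; rewrite linearP scalerDl scalerA.
  rewrite scalerA /dual_counit dual_vbaseE.
  over.
rewrite -scaler_suml; congr (_ *: _).
rewrite -[vbase j in RHS]mul1r [1 in RHS]vcoord_sum mulr_suml linear_sum.
by apply: eq_bigr => i _; rewrite -scalerAl linearZ /= mulrC.
Qed.

Lemma dual_counitr f :
  tlift (fun g h => dual_counit h *: g) (dual_comul f) = f.
Proof.
rewrite /dual_comul linear_sum [RHS]dual_sum.
apply: eq_bigr => j _; rewrite linear_sum /=.
under eq_bigr => i _.
  rewrite linearZ /= tlift_tens; first last.
  - by move=> g k h h'; rewrite linearP scalerDl scalerA.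
  - by move=> g k h h'; rewrite scalerDr !scalerA mulrC.
  rewrite scalerA /dual_counit dual_vbaseE.
  over.
rewrite -scaler_suml; congr (_ *: _).
rewrite -[vbase j in RHS]mulr1 [1 in RHS]vcoord_sum mulr_sumr linear_sum.
by apply: eq_bigr => i _; rewrite -scalerAr linearZ /= mulrC.
Qed.

HB.instance Definition _ := Vector_isCoalgebra.Build F (dual A)
  dual_comulA dual_counitl dual_counitr.

End DualCoalgebra.

(* NF is the space of coordinates on the basis 1, x, y, z: in the product of  *)
(* u and v, the terms other than u_1 v_k + u_k v_1 come from x x = x, y x = y *)
(* and x z = z.                                                               *)
Definition NF : Type := 'rV['F_2]_4.

HB.instance Definition _ := Vector.on NF.

Section NFAlgebra.

Let i0 : 'I_4 := @Ordinal 4 0 isT.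
Let ix : 'I_4 := @Ordinal 4 1 isT.
Let iy : 'I_4 := @Ordinal 4 2 isT.
Let iz : 'I_4 := @Ordinal 4 3 isT.

Definition NF1 : NF := delta_mx 0 i0.
Definition NFx : NF := delta_mx 0 ix.
Definition NFy : NF := delta_mx 0 iy.
Definition NFz : NF := delta_mx 0 iz.

Definition NFmul (u v : NF) : NF :=
  (u 0 i0 * v 0 i0) *: NF1
  + (u 0 i0 * v 0 ix + u 0 ix * v 0 i0 + u 0 ix * v 0 ix) *: NFx
  + (u 0 i0 * v 0 iy + u 0 iy * v 0 i0 + u 0 iy * v 0 ix) *: NFy
  + (u 0 i0 * v 0 iz + u 0 iz * v 0 i0 + u 0 ix * v 0 iz) *: NFz.

Lemma NF_eqP (u v : NF) :
  u 0 i0 = v 0 i0 -> u 0 ix = v 0 ix -> u 0 iy = v 0 iy -> u 0 iz = v 0 iz ->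
  u = v.
Proof.
move=> e0 ex ey ez; apply/rowP; case; case=> [|[|[|[|//]]]] lt_k4.
- by rewrite (_ : Ordinal _ = i0) //; apply: val_inj.
- by rewrite (_ : Ordinal _ = ix) //; apply: val_inj.
- by rewrite (_ : Ordinal _ = iy) //; apply: val_inj.
- by rewrite (_ : Ordinal _ = iz) //; apply: val_inj.
Qed.

Lemma NFmulE (u v : NF) :
  ((NFmul u v 0 i0 = (u 0 i0 * v 0 i0)%R)
  * (NFmul u v 0 ix = (u 0 i0 * v 0 ix + u 0 ix * v 0 i0 + u 0 ix * v 0 ix)%R)
  * (NFmul u v 0 iy = (u 0 i0 * v 0 iy + u 0 iy * v 0 i0 + u 0 iy * v 0 ix)%R)
  * (NFmul u v 0 iz =
       (u 0 i0 * v 0 iz + u 0 iz * v 0 i0 + u 0 ix * v 0 iz)%R))%type.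
Proof. by do !split; rewrite !mxE /= ?(mulr0, mulr1, addr0, add0r). Qed.

Lemma NF1E : ((NF1 0 i0 = 1%R) * (NF1 0 ix = 0%R) * (NF1 0 iy = 0%R)
  * (NF1 0 iz = 0%R))%type.
Proof. by do !split; rewrite mxE. Qed.

Lemma NFaddE (u v : NF) i : (u + v) 0 i = u 0 i + v 0 i.
Proof. exact: mxE. Qed.

Lemma NFscaleE (k : 'F_2) (u : NF) i : (k *: u) 0 i = k * u 0 i.
Proof. exact: mxE. Qed.

Lemma NFmulA : associative NFmul.
Proof.
by move=> u v w; apply: NF_eqP; rewrite !NFmulE; ring.
Qed.

Lemma NFmul1l : left_id NF1 NFmul.
Proof. by move=> u; apply: NF_eqP; rewrite !NFmulE !NF1E; ring. Qed.

Lemma NFmul1r : right_id NF1 NFmul.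
Proof. by move=> u; apply: NF_eqP; rewrite !NFmulE !NF1E; ring. Qed.

Lemma NFmulDl : left_distributive NFmul +%R.
Proof. by move=> u v w; apply: NF_eqP; rewrite !(NFaddE, NFmulE); ring. Qed.

Lemma NFmulDr : right_distributive NFmul +%R.
Proof. by move=> u v w; apply: NF_eqP; rewrite !(NFaddE, NFmulE); ring. Qed.

Lemma NF1_neq0 : NF1 != 0.
Proof. by apply/eqP => /rowP/(_ i0); rewrite !mxE. Qed.

HB.instance Definition _ := GRing.Zmodule_isNzRing.Build NF
  NFmulA NFmul1l NFmul1r NFmulDl NFmulDr NF1_neq0.

Lemma NFscaleAl (k : 'F_2) (u v : NF) : k *: (u * v) = k *: u * v.
Proof. by apply: NF_eqP; rewrite NFscaleE !NFmulE !NFscaleE; ring. Qed.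

Lemma NFscaleAr (k : 'F_2) (u v : NF) : k *: (u * v) = u * (k *: v).
Proof. by apply: NF_eqP; rewrite NFscaleE !NFmulE !NFscaleE; ring. Qed.

HB.instance Definition _ := GRing.Lmodule_isLalgebra.Build 'F_2 NF NFscaleAl.
HB.instance Definition _ := GRing.Lalgebra_isAlgebra.Build 'F_2 NF NFscaleAr.
HB.instance Definition _ := Algebra_isFalgebra.Build 'F_2 NF.

Lemma NF_mul_table :
  [/\ NFx * NFx = NFx, NFx * NFy = 0 & NFx * NFz = NFz] /\
  [/\ NFy * NFx = NFy, NFy * NFy = 0 & NFy * NFz = 0] /\
  [/\ NFz * NFx = 0, NFz * NFy = 0 & NFz * NFz = 0].
Proof. by do !split; apply: NF_eqP; rewrite !NFmulE !mxE /=; ring. Qed.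

Lemma NF_basis : basis_of fullv [:: 1 : NF; NFx; NFy; NFz].
Proof.
rewrite basisEdim dimvf leqnn andbT; apply/subvP => v _.
have -> : v = v 0 i0 *: (1 : NF) + v 0 ix *: NFx + v 0 iy *: NFy + v 0 iz *: NFz.
  by apply: NF_eqP; rewrite !NFaddE !NFscaleE !mxE /=; ring.
by rewrite !(memvD, memvZ) // memv_span // !inE eqxx ?orbT.
Qed.

End NFAlgebra.

Definition type_NF_NFdual (H : bialgType 'F_2) : Prop :=
  alg_isom H NF /\ coalg_isom H (dual NF).

Definition pairing2 (F : fieldType) (H : vectType F) (p : H -> H -> F)
    (t t' : tensor H H) : F :=
  tlift (fun a b => tlift (fun c d => p a c * p b d : F^o) t') t.

Definition nondegenerate_pairing (F : fieldType) (H : vectType F)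
    (p : {biscalar H}) : Prop :=
  (forall a, (forall b, p a b = 0) -> a = 0) /\
  (forall b, (forall a, p a b = 0) -> b = 0).

Definition selfduality_pairing (F : fieldType) (H : bialgType F)
    (p : {biscalar H}) : Prop :=
  [/\ nondegenerate_pairing p,
      forall a b c, p (a * b) c = pairing2 p (tens a b) (comul c),
      forall a b c, p a (b * c) = pairing2 p (comul a) (tens b c),
      forall a, p 1 a = counit a
    & forall a, p a 1 = counit a].

Definition self_dual (F : fieldType) (H : bialgType F) : Prop :=
  exists p : {biscalar H}, selfduality_pairing p.

(* Main.v *)
(* Let K be a noncommutative and noncocommutative Hopf algebra of dimension 4 *)
(* over F_2, and A its dual algebra, augmented by evaluation at 1, with       *)
(* augmentation ideal J. Then A is noncommutative. If J is nil, Nakayama's    *)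
(* lemma gives dim J/J^2 >= 2, so that K has two independent primitive        *)
(* elements p and q; then 1, p, q, p q is a basis and K is cocommutative.     *)
(* Otherwise A has a noncentral idempotent, hence one e with e A (1 - e) <> 0,*)
(* and the Peirce decomposition yields two distinct characters g, h of A and  *)
(* a (g, h)-skew derivation not spanned by characters, i.e. two grouplikes of *)
(* K and a skew-primitive element u outside the span of the grouplikes.       *)
(* Translation by a grouplike s <> 1 moves u out of its line modulo that      *)
(* span, which forces 1, s, u, s u to be a basis, s^2 = 1, and, up to         *)
(* replacing u by s u, an element x with Delta x = s (x) x + x (x) 1.         *)
(* Comparing coproducts, x s - s x is a multiple of 1 + s, nonzero by         *)
(* noncommutativity, and x^2 + x is primitive, hence zero: the structure of K *)
(* is determined. Conversely this table is realised on NF. Its pairing is     *)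
(* symmetric, and a |-> <a, _> is an isomorphism of coalgebras onto NF^*.     *)

Require Import Defs.
From HB Require Import structures.
From mathcomp Require Import all_boot all_order all_algebra all_field.
From mathcomp Require Import ring zify.

Set Implicit Arguments.
Unset Strict Implicit.
Unset Printing Implicit Defensive.

Import GRing.Theory VectorInternalTheory.

Local Open Scope ring_scope.

(** * Tensors and the convolution algebra *)

(** Uniqueness is obtained by doing ring theory in the dual algebra A = [conv_alg H] and reading the
    result back in H. Characters of A that are evaluations at points come from grouplike elements,
    skew derivations from skew-primitive ones ([grouplikeP], [skew_primitiveP]), and every linear
    form on A is an evaluation ([eval_at_onto]). Noncocommutativity of H says that A is
    noncommutative, and evaluation at 1 is a character eps of A.

    Since the base field is finite, every element of A has an idempotent power. If the kernel J of
    eps contains no nonzero idempotent, it is nil; were J/J^2 of dimension at most one, Nakayama's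
    lemma would make A generated by one element, so there are two independent eps-derivations
    ([nil_derivations]). They are primitives p, q of H, and the basis 1, p, q, pq makes H
    cocommutative ([primitives_cocommutative]). Otherwise A has a noncentral idempotent e, and the
    left and right actions on a nonzero block eA(1-e), or (1-e)Ae, yield two distinct characters and
    a skew derivation outside the span of all characters ([noncommutative_dichotomy],
    [hopf_dichotomy]).

    In H this gives a grouplike s different from 1 and a skew-primitive u. A dimension count shows
    that 1, s, u, su is a basis, so 1 and s are the only grouplikes and s is an involution
    ([skew_translate_free], [grouplike_two]). After a translation, x is (s,1)-skew-primitive;
    coproducts determine xs and x^2, and these determine everything else ([mulxs], [mulxx],
    [table_of_skew_basis]). Two algebras with this table are isomorphic by matching bases
    ([hopf_isom_of_table]).

    For existence, elements of NF satisfying the multiplication table are written down and the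
    axioms are checked on the basis. The pairing is checked the same way, and it also identifies the
    coalgebra with the dual of NF ([selfduality_coalg_isom]). *)

Lemma tswap_is_linear (F : fieldType) (U V : vectType F) :
  linear (@tswap F U V).
Proof. exact: tlift_is_linear. Qed.

HB.instance Definition _ (F : fieldType) (U V : vectType F) :=
  GRing.isLinear.Build F (tensor U V) (tensor V U) _ (@tswap F U V)
    (@tswap_is_linear F U V).

Section TensorLemmas.
Variable F : fieldType.
Implicit Types U V W : vectType F.

Lemma tensDl U V (u u' : U) (v : V) : tens (u + u') v = tens u v + tens u' v.
Proof. by rewrite -[u]scale1r tens_linearl !scale1r. Qed.

Lemma tensDr U V (u : U) (v v' : V) : tens u (v + v') = tens u v + tens u v'.
Proof. by rewrite -[v]scale1r tens_linearr !scale1r. Qed.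

Lemma tens0l U V (v : V) : tens (0 : U) v = 0.
Proof. by apply: (addrI (tens (0 : U) v)); rewrite -tensDl !addr0. Qed.

Lemma tensZl U V k (u : U) (v : V) : tens (k *: u) v = k *: tens u v.
Proof. by rewrite -[k *: u]addr0 tens_linearl tens0l addr0. Qed.

(* The value of f (x) g at a tensor. *)
Definition tensor_eval U V (f : U -> F) (g : V -> F) : tensor U V -> F^o :=
  tlift (fun u v => f u * g v : F^o).

Lemma tensor_evalE U V (f : {linear U -> F^o}) (g : {linear V -> F^o}) u v :
  tensor_eval f g (tens u v) = f u * g v.
Proof.
rewrite /tensor_eval tlift_tens // => w k x y.
  by rewrite linearP mulrDl scalerAl.
by rewrite linearP mulrDr scalerAr.
Qed.

Lemma tensor_eval_is_linear U V (f : U -> F) (g : V -> F) :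
  linear (tensor_eval f g).
Proof. exact: tlift_is_linear. Qed.

HB.instance Definition _ U V (f : U -> F) (g : V -> F) :=
  GRing.isLinear.Build F (tensor U V) F^o _ (tensor_eval f g)
    (tensor_eval_is_linear f g).

HB.instance Definition _ V i := GRing.isLinear.Build F V F^o _
  (@vcoord F V i) (vcoord_linear i).

Lemma tensor_eval_vcoord U V i j (t : tensor U V) :
  tensor_eval (vcoord i) (vcoord j) t = t i j.
Proof.
rewrite -[t in LHS]tlift_tens_id linear_sum /= (bigD1 i) //=.
rewrite [X in _ + X]big1 ?addr0 => [|k kNi].
  rewrite linear_sum /= (bigD1 j) //= big1 => [|l lNj].
    by rewrite addr0 linearZ /= tensor_evalE /= !vcoord_vbase !eqxx mulr1
      [LHS]mulr1.
  rewrite linearZ /= tensor_evalE /= !vcoord_vbase [j == l]eq_sym (negPf lNj).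
  by rewrite mulr0 scaler0.
rewrite linear_sum big1 // => l _.
rewrite linearZ /= tensor_evalE /= !vcoord_vbase [i == k]eq_sym (negPf kNi).
by rewrite mul0r scaler0.
Qed.

(** Coordinate forms suffice, because they read off the matrix entries of a tensor. *)
Lemma tensor_eval_inj U V (t t' : tensor U V) :
  (forall (f : {linear U -> F^o}) (g : {linear V -> F^o}),
     tensor_eval f g t = tensor_eval f g t') -> t = t'.
Proof.
by move=> tE; apply/matrixP => i j; rewrite -!tensor_eval_vcoord tE.
Qed.

(** Scalars are absorbed into the left factor, so sums of pure tensors already exhaust the space. *)
Lemma tensor_ind U V (P : tensor U V -> Prop) :
  (forall u v, P (tens u v)) -> (forall s t, P s -> P t -> P (s + t)) ->
  forall t, P t.
Proof.
move=> Pt PD t; have P0 : P 0 by rewrite -(tens0l U (0 : V)).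
rewrite -[t]tlift_tens_id; apply: (big_ind P P0 PD) => i _.
by apply: (big_ind P P0 PD) => j _; rewrite -tensZl.
Qed.

Lemma tensor_eval_tassoc U V W (f : {linear U -> F^o}) (g : {linear V -> F^o})
    (h : {linear W -> F^o}) t :
  tensor_eval f (tensor_eval g h) (tassoc t) =
  tensor_eval (tensor_eval f g) h t.
Proof.
elim/tensor_ind: t => [s w | s t Ps Pt]; last by rewrite !linearD /= Ps Pt.
elim/tensor_ind: s => [u v | s t Ps Pt].
  by rewrite tassoc_tens !tensor_evalE /= !tensor_evalE mulrA.
by rewrite tensDl !linearD /= Ps Pt.
Qed.

Lemma tensor_eval_tmap U V U' V' (a : {linear U -> U'}) (b : {linear V -> V'})
    (f : {linear U' -> F^o}) (g : {linear V' -> F^o}) t :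
  tensor_eval f g (tmap a b t) = tensor_eval (f \o a) (g \o b) t.
Proof.
elim/tensor_ind: t => [u v | s t Ps Pt]; last by rewrite !linearD /= Ps Pt.
by rewrite tmap_tens !tensor_evalE.
Qed.

Lemma eq_tensor_eval U V (f f' : U -> F) (g g' : V -> F) :
  f =1 f' -> g =1 g' -> tensor_eval f g =1 tensor_eval f' g'.
Proof. by move=> ff gg; apply: eq_tlift => u v; rewrite ff gg. Qed.

End TensorLemmas.

Section TensorProductAlgebra.
Variables (F : fieldType) (A B : falgType F).
Implicit Types s t : tensor A B.

Lemma tmulDl s s' t : tmul (s + s') t = tmul s t + tmul s' t.
Proof. exact: linearD. Qed.

Lemma tmulDr s t t' : tmul s (t + t') = tmul s t + tmul s t'.
Proof.
rewrite -[tmul s t]scale1r /tmul -tlift_fun_linear; apply: eq_tlift => a b.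
by rewrite scale1r linearD.
Qed.

Lemma tmulZl k s t : tmul (k *: s) t = k *: tmul s t.
Proof. exact: linearZ. Qed.

Lemma tmulZr k s t : tmul s (k *: t) = k *: tmul s t.
Proof.
rewrite -[RHS]addr0 -[0](_ : tmul s 0 = 0); last first.
  by apply: (addrI (tmul s 0)); rewrite -tmulDr !addr0.
rewrite /tmul -tlift_fun_linear; apply: eq_tlift => a b.
by rewrite linear0 addr0 linearZ.
Qed.

Lemma tlift_mull (f : {linear A -> A}) u v :
  tlift (fun b c : A => f b * c) (tens u v) = f u * v.
Proof.
by rewrite tlift_tens // => y k z t; rewrite ?linearP ?mulrDl ?mulrDr
  -?scalerAl -?scalerAr.
Qed.

Lemma tlift_mulr (f : {linear A -> A}) u v :
  tlift (fun b c : A => b * f c) (tens u v) = u * f v.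
Proof.
by rewrite tlift_tens // => y k z t; rewrite ?linearP ?mulrDl ?mulrDr
  -?scalerAl -?scalerAr.
Qed.

Lemma tlift_scalel (f : {scalar A}) (u v : A) :
  tlift (fun a b => f a *: b) (tens u v) = f u *: v.
Proof.
by rewrite tlift_tens // => y k z t; rewrite ?linearP ?scalerDl ?scalerDr
  ?scalerA // mulrC.
Qed.

Lemma tlift_scaler (f : {scalar A}) (u v : A) :
  tlift (fun a b => f b *: a) (tens u v) = f v *: u.
Proof.
by rewrite tlift_tens // => y k z t; rewrite ?linearP ?scalerDl ?scalerDr
  ?scalerA // mulrC.
Qed.

End TensorProductAlgebra.

Section ConvolutionAlgebra.
Variables (F : fieldType) (H : bialgType F).

(** A second name for the carrier of [dual H]: there the product of H induces a coproduct, here the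
    coproduct of H induces a product. *)
Definition conv_alg : Type := 'Hom(H, F^o).

HB.instance Definition _ := Vector.on conv_alg.

Implicit Types f g h : conv_alg.

Definition conv f g : conv_alg :=
  linfun (tensor_eval (f : 'Hom(H, F^o)) (g : 'Hom(H, F^o)) \o comul).

Definition conv1 : conv_alg := linfun (counit : {linear H -> F^o}).

Lemma convE f g a : conv f g a = tensor_eval f g (comul a).
Proof.
exact: (lfunE (tensor_eval (f : 'Hom(H, F^o)) (g : 'Hom(H, F^o)) \o comul)).
Qed.

Lemma conv1E a : conv1 a = counit a.
Proof. exact: (lfunE (counit : {linear H -> F^o})). Qed.

Lemma convA : associative conv.
Proof.
move=> f g h; apply/lfunP => a; rewrite !convE.
transitivity (tensor_eval f (tensor_eval g h) (tmap idfun comul (comul a))).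
  rewrite tensor_eval_tmap; apply: eq_tensor_eval => // b; exact: convE.
rewrite -comulA tensor_eval_tassoc tensor_eval_tmap.
by apply: eq_tensor_eval => // b; rewrite convE.
Qed.

Lemma conv1l : left_id conv1 conv.
Proof.
move=> f; apply/lfunP => a; rewrite convE -[a in RHS]counitl.
elim/tensor_ind: (comul a) => [u v | s t Ps Pt].
  rewrite tensor_evalE tlift_tens /= => [|w k x y|w k x y].
  - by rewrite conv1E linearZ.
  - by rewrite linearP scalerDl scalerA.
  - by rewrite scalerDr !scalerA mulrC.
by rewrite !linearD /= Ps Pt.
Qed.

Lemma conv1r : right_id conv1 conv.
Proof.
move=> f; apply/lfunP => a; rewrite convE -[a in RHS]counitr.
elim/tensor_ind: (comul a) => [u v | s t Ps Pt].
  rewrite tensor_evalE tlift_tens /= => [|w k x y|w k x y].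
  - by rewrite conv1E linearZ mulrC.
  - by rewrite scalerDr !scalerA mulrC.
  - by rewrite linearP scalerDl scalerA.
by rewrite !linearD /= Ps Pt.
Qed.

Lemma convDl : left_distributive conv +%R.
Proof.
move=> f g h; apply/lfunP => a; rewrite add_lfunE !convE.
elim/tensor_ind: (comul a) => [u v | s t Ps Pt].
  by rewrite !tensor_evalE /= add_lfunE mulrDl.
by rewrite !linearD /= Ps Pt addrACA.
Qed.

Lemma convDr : right_distributive conv +%R.
Proof.
move=> f g h; apply/lfunP => a; rewrite add_lfunE !convE.
elim/tensor_ind: (comul a) => [u v | s t Ps Pt].
  by rewrite !tensor_evalE /= add_lfunE mulrDr.
by rewrite !linearD /= Ps Pt addrACA.
Qed.

Lemma conv1_neq0 : conv1 != 0.
Proof.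
apply/eqP => /lfunP/(_ 1); rewrite conv1E counit1 lfunE /= => /eqP.
by rewrite oner_eq0.
Qed.

HB.instance Definition _ := GRing.Zmodule_isNzRing.Build conv_alg
  convA conv1l conv1r convDl convDr conv1_neq0.

Lemma convZl k f g : k *: (f * g) = k *: f * g.
Proof.
apply/lfunP => a; rewrite scale_lfunE !convE.
elim/tensor_ind: (comul a) => [u v | s t Ps Pt].
  by rewrite !tensor_evalE /= scale_lfunE scalerAl.
by rewrite !linearD /= Ps Pt.
Qed.

Lemma convZr k f g : k *: (f * g) = f * (k *: g).
Proof.
apply/lfunP => a; rewrite scale_lfunE !convE.
elim/tensor_ind: (comul a) => [u v | s t Ps Pt].
  by rewrite !tensor_evalE /= scale_lfunE scalerAr.
by rewrite !linearD /= Ps Pt.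
Qed.

HB.instance Definition _ := GRing.Lmodule_isLalgebra.Build F conv_alg convZl.
HB.instance Definition _ := GRing.Lalgebra_isAlgebra.Build F conv_alg convZr.
HB.instance Definition _ := Algebra_isFalgebra.Build F conv_alg.
End ConvolutionAlgebra.

(** * Augmented algebras of dimension four *)

Section LinearAlgebra.
Variables (F : fieldType) (V : vectType F).

Lemma separating_functional (W : {vspace V}) v : v \notin W ->
  exists f : {linear V -> F^o}, f v = 1 /\ forall w, w \in W -> f w = 0.
Proof.
move=> vW; have X_W : <<vbasis W>>%VS = W := span_basis (vbasisP W).
have [f fE] := linear_of_free (v :: vbasis W) (1 :: nseq (\dim W) 0 : seq F^o).
have {}fE : map f (v :: vbasis W) = 1 :: nseq (\dim W) 0.
  apply: fE; last by rewrite /= size_nseq size_tuple.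
  by rewrite free_cons X_W vW (basis_free (vbasisP W)).
move: fE => /= -[fv fX].
exists f; split=> // w; rewrite -X_W => wX; apply/eqP.
rewrite -(lfunE f) -memv_ker; apply: (subvP _ w wX); apply/span_subvP => x xX.
rewrite memv_ker lfunE; have: f x \in map f (vbasis W) by apply: map_f.
by rewrite fX mem_nseq => /andP[].
Qed.

Lemma free4P (a b c d : V) :
  (forall k l m n, k *: a + l *: b + m *: c + n *: d = 0 ->
     [/\ k = 0, l = 0, m = 0 & n = 0]) -> free [:: a; b; c; d].
Proof.
move=> abcd; change (free [tuple a; b; c; d]); apply/freeP => k.
rewrite !big_ord_recl big_ord0 /= addr0 !addrA => /abcd[k0 k1 k2 k3].
case; case=> [|[|[|[|//]]]] i4;
  [rewrite -[RHS]k0 | rewrite -[RHS]k1 | rewrite -[RHS]k2 | rewrite -[RHS]k3];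
  by congr k; apply: val_inj.
Qed.

Lemma span4P (a b c d : V) : \dim {:V} = 4%N -> free [:: a; b; c; d] ->
  forall v, exists k l m n, v = k *: a + l *: b + m *: c + n *: d.
Proof.
move=> dimV /eqP dX v.
have : v \in <<[:: a; b; c; d]>>%VS.
  suff -> : <<[:: a; b; c; d]>>%VS = fullv by apply: memvf.
  by apply/eqP; rewrite eqEdim subvf dimV dX.
rewrite !span_cons span_nil addv0.
case/memv_addP=> ? /vlineP[k ->] [? /memv_addP[? /vlineP[l ->] [? +]]].
case/memv_addP=> ? /vlineP[m ->] [? /vlineP[n ->] ->] -> ->.
by exists k, l, m, n; rewrite !addrA.
Qed.

End LinearAlgebra.

(** By the pigeonhole principle two powers agree, so the powers are eventually periodic; an exponent
    that is a multiple of the period and lies beyond the preperiod gives an idempotent. *)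
Lemma idempotent_power (F : finFieldType) (A : falgType F) (a : A) :
  exists2 n, (0 < n)%N & a ^+ n * a ^+ n = a ^+ n.
Proof.
pose f (i : 'I_(#|finvect_type A|.+1)) : finvect_type A := a ^+ i.
have [i [j [lt_ij fij]]] : exists i j : nat, (i < j)%N /\ a ^+ i = a ^+ j.
  have /injectivePn[i [j ij fij]] : ~~ injectiveb f.
    apply/negP => /injectiveP/leq_card; rewrite card_ord.
    by rewrite ltnn.
  case: (ltngtP i j) => [ltij|ltji|/val_inj eqij].
  - by exists i, j.
  - by exists j, i.
  - by rewrite eqij eqxx in ij.
pose m := (j - i)%N.
have am l q : (i <= l)%N -> a ^+ (l + q * m) = a ^+ l.
  move=> il; elim: q => [|q IHq]; first by rewrite addn0.
  have -> : (l + q.+1 * m = j + (l - i + q * m))%N by rewrite mulSn /m; lia.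
  by rewrite exprD -fij -exprD addnA subnKC.
exists (j * m)%N; first by rewrite muln_gt0 subn_gt0 lt_ij (leq_ltn_trans _
  lt_ij).
rewrite -exprD am //; apply: leq_trans (ltnW lt_ij) _.
by rewrite leq_pmulr // subn_gt0.
Qed.

(** * Nakayama's lemma and derivations of an algebra with nil augmentation ideal *)

Section Nakayama.
Variables (F : fieldType) (A : falgType F).
Implicit Types J U V : {vspace A}.

Lemma nilpotent_geometric (j : A) n : j ^+ n = 0 -> exists z, (1 - j) * z = 1.
Proof.
move=> jn; exists (\sum_(i < n) j ^+ i).
by apply: oppr_inj; rewrite -mulNr opprB -subrX1 jn sub0r.
Qed.

Lemma memv_line_prod x V w :
  w \in (<[x]> * V)%VS -> exists2 v, v \in V & w = x * v.
Proof.
suff xV : (<[x]> * V <= amull x @: V)%VS.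
  by move/(subvP xV)/memv_imgP=> [v vV ->]; exists v; rewrite ?lfunE.
apply/prodvP => _ v /vlineP[k ->] vV; rewrite -scalerAl memvZ //.
by apply/memv_imgP; exists v; rewrite ?lfunE.
Qed.

(* A minimal set of generators of J modulo U must be empty: a generator x     *)
(* satisfies x (1 - j) in the span of the others for some j in J, and 1 - j   *)
(* is invertible.                                                             *)
Lemma nil_nakayama J U :
  (forall j, j \in J -> exists n, j ^+ n = 0) ->
  (fullv * J <= J)%VS -> (U * fullv <= U)%VS ->
  (J <= U + J * J)%VS -> (J <= U)%VS.
Proof.
move=> nilJ AJ UA JU2.
pose gen (X : seq A) := foldr (fun x V => V + <[x]> * fullv)%VS U X.
have genA X : (gen X * fullv <= gen X)%VS.
  elim: X => //= x X IHX; rewrite prodvDl addvS // -prodvA prodvSr //.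
  exact: subvf.
have genU X : (U <= gen X)%VS.
  by elim: X => //= x X IHX; apply: subv_trans IHX (addvSl _ _).
suff Jgen X : {subset X <= J} -> (J <= gen X)%VS -> (J <= U)%VS.
  apply: (Jgen (vbasis J)) => [x|]; first exact: vbasis_mem.
  rewrite -{1}(span_basis (vbasisP J)); apply/span_subvP => v.
  elim: (vbasis J : seq A) => //= x X IHX; rewrite inE => /orP[/eqP-> | vX].
    apply: (subvP (addvSr _ _)); rewrite -[x in x \in _]mulr1.
    by rewrite memv_mul ?memv_line ?memvf.
  exact: (subvP (addvSl _ _) _ (IHX vX)).
elim: X => [|x X IHX] XJ //= JX.
have xJ : x \in J by apply: XJ; rewrite mem_head.
suff xX : x \in gen X.
  apply: IHX => [y yX|]; first by apply: XJ; rewrite inE yX orbT.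
  apply: subv_trans JX _; rewrite subv_add subvv.
  by apply: subv_trans (genA X); apply: prodvSl; rewrite -memvE.
have : x \in (gen X + <[x]> * J)%VS.
  apply: (subvP _ x xJ); apply: subv_trans JU2 _; rewrite subv_add.
  rewrite (subv_trans (genU X) (addvSl _ _)) /=.
  apply: subv_trans (prodvSl _ JX) _; rewrite prodvDl addvS //.
    exact: subv_trans (prodvSr _ (subvf _)) (genA X).
  by rewrite -prodvA prodvSr.
case/memv_addP => v vX [_ /memv_line_prod[j jJ ->] xE].
have [n jn] := nilJ j jJ; have [z jz] := nilpotent_geometric jn.
have -> : x = v * z by rewrite -[x]mulr1 -jz mulrA mulrBr mulr1 {1}xE addrK.
apply: (subvP (genA X)); apply: memv_mul => //; exact: memvf.
Qed.

(* If J = <a> + J^2, Nakayama's lemma gives J = aA, so that A = F[a].         *)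
Lemma nil_augmentation_comm (eps : {linear A -> F^o}) (a : A) :
  (forall b, eps (b - (eps b : F)%:A) = 0) ->
  let J := lker (linfun eps) in
  (forall j, j \in J -> exists n, j ^+ n = 0) ->
  (fullv * J <= J)%VS -> a \in J -> (J <= <[a]> + J * J)%VS ->
  commutative (@GRing.mul A).
Proof.
move=> eps1 J nilJ AJ aJ JaJ.
have JaA : (J <= <[a]> * fullv)%VS.
  apply: nil_nakayama => //; first by rewrite -prodvA prodvSr ?subvf.
  apply: subv_trans JaJ _; rewrite addvS // -{1}[(<[a]>)%VS]prodv1.
  by rewrite prodvSr ?subvf.
suff poly_a b : exists p, b = horner_alg a p.
  by move=> b c; have [[p ->] [q ->]] := (poly_a b, poly_a c);
    rewrite -!rmorphM mulrC.
(* Expansion in powers of a: the remainder w is its augmentation plus an element of J = aA, which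
   raises the power of a by one. Nilpotency of a then removes the remainder. *)
have step n v : exists p w, v = horner_alg a p + a ^+ n * w.
  elim: n => [|n [p [w ->]]]; first by exists 0, v; rewrite rmorph0 add0r mul1r.
  have /(subvP JaA)/memv_line_prod[w' _ wE] : w - (eps w : F)%:A \in J.
    by rewrite memv_ker lfunE /= eps1.
  exists (p + (eps w : F) *: 'X^n), w'; rewrite rmorphD /= linearZ /= rmorphXn
    /=.
  rewrite horner_algX -[w in LHS](subrK (eps w : F)%:A) wE mulrDr exprSr -mulrA.
  by rewrite -scalerAr mulr1 addrA addrAC mulr_algl.
have [n an] := nilJ a aJ.
by have [p [w ->]] := step n b; exists p; rewrite an mul0r addr0.
Qed.

Definition character (g : A -> F) :=
  g 1 = 1 /\ forall a b, g (a * b) = g a * g b.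

Definition skew_derivation (g h u : A -> F) :=
  forall a b, u (a * b) = g a * u b + u a * h b.

(** Here J has dimension 3. If J^2 had dimension at least 2, then J would be generated modulo J^2 by
    at most one element and A would be commutative. So 1 and J^2 span at most a plane W, and any
    linear form vanishing on W is an eps-derivation. *)
Lemma nil_derivations (eps : {linear A -> F^o}) :
  \dim {:A} = 4%N -> noncommutative A -> character eps ->
  (forall j, eps j = 0 -> exists n, j ^+ n = 0) ->
  exists (p q : {linear A -> F^o}) (a b : A),
    [/\ skew_derivation eps eps p, skew_derivation eps eps q,
        eps a = 0 /\ eps b = 0 &
        [/\ p a = 1, p b = 0, q a = 0 & q b = 1]].
Proof.
move=> dimA ncA [eps1 epsM] nil_eps.
have epsB b : eps (b - (eps b : F)%:A) = 0.
  by rewrite linearB linearZ /= eps1 [_ *: _]mulr1 subrr.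
pose J := lker (linfun eps).
have memJ b : (b \in J) = (eps b == 0) by rewrite memv_ker lfunE.
have AJ : (fullv * J <= J)%VS.
  apply/prodvP => b j _; rewrite !memJ epsM => /eqP->; by rewrite mulr0.
have JJ : (J * J <= J)%VS by apply: subv_trans (prodvSl _ (subvf _)) AJ.
have J1 : (<[1]> + J)%VS = fullv.
  apply/eqP; rewrite eqEsubv subvf; apply/subvP => b _;
    rewrite -[b](subrK (eps b : F)%:A) addrC.
  by rewrite memv_add ?memvZ ?memv_line // memJ epsB.
have dimJ : \dim J = 3%N.
  have J1_0 : (<[1]> :&: J)%VS = 0%VS.
    apply/eqP; rewrite -subv0; apply/subvP => b; rewrite memv_cap memJ memv0.
    case/andP=> /vlineP[k ->]; rewrite linearZ /= eps1 [_ *: _]mulr1 => /eqP->.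
    by rewrite scale0r.
  have := dimv_disjoint_sum J1_0; by rewrite J1 dimA dim_vline oner_eq0 => -[].
have nilJ j : j \in J -> exists n, j ^+ n = 0 by rewrite memJ => /eqP/nil_eps.
have [dimJJ | dimJJ] := leqP (\dim (J * J)%VS) 1; last first.
  case: ncA.
  have [JJe | /subvPn[a aJ aJJ]] := boolP (J <= J * J)%VS.
    apply: (@nil_augmentation_comm eps 0) => //; first exact: mem0v.
    by apply: subv_trans JJe (addvSr _ _).
  apply: (@nil_augmentation_comm eps a) => //.
  have aJs : (<[a]> + J * J <= J)%VS by rewrite subv_add JJ -memvE aJ.
  suff /eqP-> : (<[a]> + J * J)%VS == J by apply: subvv.
  rewrite eqEdim aJs dimJ dimv_disjoint_sum; last first.
    apply/eqP; rewrite -subv0; apply/subvP => b; rewrite memv_cap memv0.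
    case/andP=> /vlineP[k ->]; have [->|k0] := eqVneq k 0; first
      by rewrite scale0r.
    by move=> kaJJ; case/negP: aJJ; rewrite -(scalerK k0 a) memvZ.
  rewrite dim_vline; case: eqP aJJ => [->|_ _ /=]; first by rewrite mem0v.
  by rewrite add1n ltnS.
pose W := (<[1]> + J * J)%VS.
have dimW : (\dim W <= 2)%N.
  apply: leq_trans (dimv_add_leqif _ _) _; rewrite dim_vline oner_eq0 /=; lia.
have outside (U : {vspace A}) : (\dim U <= 3)%N -> exists b, b \notin U.
  move=> dimU; have /subvPn[b _ bU] : ~~ (fullv <= U)%VS.
    by apply/negP => /dimvS; rewrite dimA; lia.
  by exists b.
have [b1 b1W] := outside W (leqW dimW).
have [p [pb1 pW]] := separating_functional b1W.
have [b2 b2W] : exists b, b \notin (<[b1]> + W)%VS.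
  apply: outside; apply: leq_trans (dimv_add_leqif _ _) _;
    by rewrite dim_vline (leq_trans (leq_add (leq_b1 _) dimW)).
have [q [qb2 qW]] := separating_functional b2W.
have deriv (f : {linear A -> F^o}) :
    (forall w, w \in W -> f w = 0) -> skew_derivation eps eps f.
  move=> fW x y.
  have f1 : f 1 = 0 by rewrite fW // (subvP (addvSl _ _)) ?memv_line.
  have : f ((x - (eps x : F)%:A) * (y - (eps y : F)%:A)) = 0.
    rewrite fW // (subvP (addvSr _ _)) // memv_mul // memJ epsB //.
  rewrite mulrBr !mulrBl !linearB /= -!scalerAl -!scalerAr !mul1r !mulr1
    !linearZ /=.
  rewrite f1 /GRing.scale /= => fxy; apply/eqP; rewrite -subr_eq0 -fxy;
    apply/eqP.
  by ring.
have q0 w : w \in W -> q w = 0 by move=> wW; rewrite qW // (subvP (addvSr _ _)).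
have qb1 : q b1 = 0 by rewrite qW // (subvP (addvSl _ _)) ?memv_line.
have p1 : p 1 = 0 by rewrite pW // (subvP (addvSl _ _)) ?memv_line.
have q1 : q 1 = 0 by rewrite q0 // (subvP (addvSl _ _)) ?memv_line.
(* This correction makes the values of p and q at b1, c dual to each other; subtracting
   augmentations changes nothing, since p and q kill 1. *)
pose c := b2 - (p b2 : F) *: b1.
exists p, q, (b1 - (eps b1 : F)%:A), (c - (eps c : F)%:A); split;
  try exact: deriv.
  by rewrite !epsB.
have pE v k : p (v - k%:A) = p v by rewrite linearB linearZ /= p1 scaler0 subr0.
have qE v k : q (v - k%:A) = q v by rewrite linearB linearZ /= q1 scaler0 subr0.
by rewrite !pE !qE /c !linearB !linearZ /= pb1 qb1 qb2; split=> //;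
  rewrite /GRing.scale /=; ring.
Qed.

End Nakayama.

(** * Peirce decomposition with respect to an idempotent *)

Section Peirce.
Variables (F : fieldType) (A : falgType F).
Hypothesis dimA : \dim {:A} = 4%N.
Variables (e f : A).
Hypotheses (ee : e * e = e) (ef : e + f = 1).

Let fe0 : f * e = 0.
Proof. by apply: (addrI e); rewrite -{1}ee -mulrDl ef mul1r addr0. Qed.
Let ef0 : e * f = 0.
Proof. by apply: (addrI e); rewrite -{1}ee -mulrDr ef mulr1 addr0. Qed.
Let ff : f * f = f.
Proof. by rewrite -[RHS]mul1r -ef mulrDl ef0 add0r. Qed.

(** The four elements are nonzero and lie in four different Peirce blocks, so multiplying a relation
    by e or f on each side isolates each term. *)
Lemma peirce_free4 y z : e * y = y -> y * f = y -> f * z = z -> z * e = z ->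
  y != 0 -> z != 0 -> free [:: e; f; y; z].
Proof.
move=> ey yf fz ze y0 z0.
have ye : y * e = 0 by rewrite -yf -mulrA fe0 mulr0.
have fy : f * y = 0 by rewrite -ey mulrA fe0 mul0r.
have ez : e * z = 0 by rewrite -fz mulrA ef0 mul0r.
have zf : z * f = 0 by rewrite -ze -mulrA ef0 mulr0.
have e0 : e != 0 by apply: contraNneq y0 => e0; rewrite -ey e0 mul0r.
have f0 : f != 0 by apply: contraNneq y0 => f0; rewrite -yf f0 mulr0.
have kill (k : F) (v : A) : v != 0 -> k *: v = 0 -> k = 0.
  by move=> v0 /eqP; rewrite scaler_eq0 (negPf v0) orbF => /eqP.
apply: free4P => k l m n rel.
have E p q : p * (k *: e + l *: f + m *: y + n *: z) * q = 0
  by rewrite rel mulr0 mul0r.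
have H := (ee, ef0, fe0, ff, ey, yf, ye, fy, fz, ze, ez, zf, mul0r, scaler0,
  addr0, add0r).
split; [move: (E e e) | move: (E f f) | move: (E e f) | move: (E f e)];
  rewrite !(mulrDl, mulrDr) -!scalerAr -!scalerAl !H; exact: kill.
Qed.

(** If y and z are nonzero, every block is a line and associativity gives yz = ke, zy = kf with the
    same k. A nonzero k would make A a matrix algebra, and the character would vanish at e and f,
    hence at 1. *)
Lemma peirce_triple (eps : {linear A -> F^o}) y z :
  character eps -> e * y = y -> y * f = y -> f * z = z -> z * e = z ->
  y * z = 0 /\ z * y = 0.
Proof.
move=> [eps1 epsM] ey yf fz ze.
have [->|y0] := eqVneq y 0; first by rewrite mul0r mulr0.
have [->|z0] := eqVneq z 0; first by rewrite mul0r mulr0.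
have ye : y * e = 0 by rewrite -yf -mulrA fe0 mulr0.
have fy : f * y = 0 by rewrite -ey mulrA fe0 mul0r.
have ez : e * z = 0 by rewrite -fz mulrA ef0 mul0r.
have zf : z * f = 0 by rewrite -ze -mulrA ef0 mulr0.
have span := span4P dimA (peirce_free4 ey yf fz ze y0 z0).
have H := (ee, ef0, fe0, ff, ey, yf, ye, fy, fz, ze, ez, zf, mul0r, scaler0,
  addr0, add0r).
have [k yzE] : exists k, y * z = k *: e.
  have [k [l [m [n yzE]]]] := span (y * z); exists k.
  have -> : y * z = e * (y * z) * e by rewrite mulrA ey -mulrA ze.
  by rewrite yzE !(mulrDl, mulrDr) -!scalerAr -!scalerAl !H.
have [l zyE] : exists l, z * y = l *: f.
  have [k' [l [m [n zyE]]]] := span (z * y); exists l.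
  have -> : z * y = f * (z * y) * f by rewrite mulrA fz -mulrA yf.
  by rewrite zyE !(mulrDl, mulrDr) -!scalerAr -!scalerAl !H.
have kl : k = l.
  apply/eqP; rewrite -subr_eq0; apply: contraNT z0 => kl; apply/eqP.
  apply: (scalerI kl); rewrite scaler0 scalerBl.
  by rewrite -{1}ze scalerAr -yzE mulrA zyE -scalerAl fz subrr.
rewrite -kl in zyE; have [k0|k0] := eqVneq k 0.
  by rewrite yzE zyE k0 !scale0r.
have epsef : eps e * eps f = 0 by rewrite -epsM ef0 linear0.
have epsy : eps y = 0.
  by rewrite -yf -ey !epsM [eps e * _]mulrC -mulrA epsef mulr0.
have epse : eps e = 0.
  by apply: (scalerI k0); rewrite -linearZ -yzE epsM epsy mul0r scaler0.
have epsf : eps f = 0.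
  by apply: (scalerI k0); rewrite -linearZ -zyE epsM epsy mulr0 scaler0.
by move/eqP: eps1; rewrite -ef linearD /= epse epsf addr0 eq_sym oner_eq0.
Qed.

(* When eAf is not a line, e, f and two elements of eAf form a basis. *)
Lemma peirce_scalars b : e * b * f != 0 ->
  (forall z, exists k, e * z * f = k *: (e * b * f)) \/
  (forall a, (exists k, e * a * e = k *: e) /\ (exists k, f * a * f = k *: f)).
Proof.
set y := e * b * f => y0.
have ey : e * y = y by rewrite /y !mulrA ee.
have yf : y * f = y by rewrite /y -mulrA ff.
have [/subvP line | /subvPn[y' y'P y'y]] :=
  boolP (<[e]> * fullv * <[f]> <= <[y]>)%VS.
  left=> z; apply/vlineP/line; rewrite memv_mul ?memv_line //.
  by rewrite memv_mul ?memv_line ?memvf.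
right; have [ey' y'f] : e * y' = y' /\ y' * f = y'.
  have /memv_cosetP[_ /memv_line_prod[z _ ->] ->] := y'P.
  by split; [rewrite !mulrA ee | rewrite -mulrA ff].
have [ye y'e] : y * e = 0 /\ y' * e = 0.
  by rewrite -yf -y'f -!mulrA fe0 !mulr0.
have [fy fy'] : f * y = 0 /\ f * y' = 0.
  by rewrite -ey -ey' !mulrA fe0 !mul0r.
have e0 : e != 0 by apply: contraNneq y0 => e0; rewrite -ey e0 mul0r.
have f0 : f != 0 by apply: contraNneq y0 => f0; rewrite -yf f0 mulr0.
have H := (ee, ef0, fe0, ff, ey, yf, ye, fy, ey', y'f, y'e, fy', mul0r,
  scaler0, addr0, add0r).
have kill (k : F) (v : A) : v != 0 -> k *: v = 0 -> k = 0.
  by move=> v0 /eqP; rewrite scaler_eq0 (negPf v0) orbF => /eqP.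
have dX : free [:: e; f; y; y'].
  apply: free4P => k l m n rel.
  have E p q : p * (k *: e + l *: f + m *: y + n *: y') * q = 0
    by rewrite rel mulr0 mul0r.
  have k0 : k = 0.
    by move: (E e e); rewrite !(mulrDl, mulrDr) -!scalerAr -!scalerAl !H;
      apply: kill.
  have l0 : l = 0.
    by move: (E f f); rewrite !(mulrDl, mulrDr) -!scalerAr -!scalerAl !H;
      apply: kill.
  move: rel; rewrite k0 l0 !scale0r !add0r => rel.
  have n0 : n = 0.
    apply/eqP; apply: contraNT y'y => n0.
    rewrite -(scalerK n0 y') memvZ //; apply/vlineP; exists (- m).
    by apply/eqP; rewrite scaleNr -addr_eq0 addrC rel.
  by move: rel; rewrite n0 scale0r addr0 => /(kill _ _ y0).
move=> a; have [k [l [m [n ->]]]] := span4P dimA dX a.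
by split; [exists k | exists l];
  rewrite !(mulrDl, mulrDr) -!scalerAr -!scalerAl !H.
Qed.

(* g and h give the action of eAe and fAf on eAf, where they act by scalars,  *)
(* and u is a linear form on eAf extended to A by a |-> e a f.                *)
Lemma peirce_skew_derivation (eps : {linear A -> F^o}) b :
  character eps -> e * b * f != 0 ->
  exists (g h u : {linear A -> F^o}) (y : A),
    [/\ character g, character h, skew_derivation g h u, g e <> h e & u y = 1 /\
        forall chi : A -> F, character chi -> chi 0 = 0 -> chi y = 0].
Proof.
move=> epsP y0; have scalars := peirce_scalars y0; move: y0 scalars.
set y := e * b * f => y0 scalars; have yE : y = e * b * f by [].
clearbody y.
have ey : e * y = y by rewrite yE !mulrA ee.
have yf : y * f = y by rewrite yE -mulrA ff.
have ye : y * e = 0 by rewrite -yf -mulrA fe0 mulr0.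
have [lam [lamy _]] : exists lam : {linear A -> F^o},
    lam y = 1 /\ forall w, w \in 0%VS -> lam w = 0.
  by apply: separating_functional; rewrite memv0.
pose g : {linear A -> F^o} := lam \o (y \o* (e \*o idfun)).
pose h : {linear A -> F^o} := lam \o (f \o* (y \*o idfun)).
pose u : {linear A -> F^o} := lam \o (f \o* (e \*o idfun)).
have gE a z : e * a * (e * z * f) = (g a : F) *: (e * z * f).
  rewrite /g /=; case: scalars => [line | scal].
    have [k ->] := line z; have [l aE] := line (a * y).
    have {}aE : e * a * y = l *: y by rewrite -aE -[RHS]mulrA -[a * y * f]mulrA
      yf mulrA.
    by rewrite -scalerAr aE [lam _]linearZ /= lamy [l *: 1]mulr1 !scalerA mulrC.
  have [[k aE] _] := scal a.
  have -> : e * a * y = k *: y by rewrite -{1}ey mulrA aE -scalerAl ey.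
  by rewrite [lam _]linearZ /= lamy [k *: 1]mulr1 !mulrA aE -!scalerAl.
have hE a z : (e * z * f) * a * f = (h a : F) *: (e * z * f).
  rewrite /h /=; case: scalars => [line | scal].
    have [k ->] := line z; have [l aE] := line (y * a).
    have {}aE : y * a * f = l *: y by rewrite -aE mulrA ey.
    by rewrite -!scalerAl aE [lam _]linearZ /= lamy [l *: 1]mulr1 !scalerA
      mulrC.
  have [_ [k aE]] := scal a.
  have -> : y * a * f = k *: y by rewrite -{1}yf -!mulrA [f * (a * f)]mulrA aE
    -scalerAr yf.
  by rewrite [lam _]linearZ /= lamy [k *: 1]mulr1 -!mulrA [f * (a * f)]mulrA aE
    -!scalerAr.
(* Inserting 1 = e + f inside a product splits it in two; by [corner] the products of opposite
   off-diagonal blocks vanish, so g and h are multiplicative. *)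
have mid a c : a * c = a * e * c + a * f * c by rewrite -mulrDl -mulrDr ef
  mulr1.
have corner a c :
    (e * a * f) * (f * c * e) = 0 /\ (f * c * e) * (e * a * f) = 0.
  apply: (peirce_triple epsP).
  - by rewrite !mulrA ee.
  - by rewrite -mulrA ff.
  - by rewrite !mulrA ff.
  - by rewrite -mulrA ee.
have gyE a : e * a * y = (g a : F) *: y by rewrite [in LHS]yE gE -yE.
have hyE a : y * a * f = (h a : F) *: y by rewrite [in LHS]yE hE -yE.
have gP : character g.
  split=> [|a c]; first by rewrite /g /= mulr1 ey.
  have -> : g (a * c) = lam (e * a * (e * c * y)).
    rewrite /g /= [a * c]mid mulrDr mulrDl [lam _]linearD /=.
    have -> : e * (a * f * c) * y = 0.
      rewrite -[y]ey -[f]ff !mulrA.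
      have := (corner a c).1; rewrite !mulrA => /(congr1 ( *%R^~ y)).
      by rewrite mul0r -!mulrA.
    by rewrite linear0 addr0 !mulrA.
  by rewrite gyE -scalerAr gyE !linearZ /= lamy [_ *: 1]mulr1 [LHS]mulrC.
have hP : character h.
  split=> [|a c]; first by rewrite /h /= mulr1 yf.
  have -> : h (a * c) = lam (y * a * f * c * f).
    rewrite /h /= [a * c]mid mulrDr mulrDl [lam _]linearD /=.
    have -> : y * (a * e * c) * f = 0.
      rewrite -[y]yf -[e]ee !mulrA.
      have := (corner c a).2; rewrite !mulrA => /(congr1 ( *%R y)).
      by rewrite mulr0 !mulrA.
    by rewrite linear0 add0r !mulrA.
  by rewrite hyE -!scalerAl hyE !linearZ /= lamy [_ *: 1]mulr1.
exists g, h, u, y; split=> //.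
- move=> a c; rewrite /u /= [a * c]mid mulrDr mulrDl [lam _]linearD /=.
  have -> : e * (a * e * c) * f = e * a * (e * c * f) by rewrite !mulrA.
  have -> : e * (a * f * c) * f = e * a * f * c * f by rewrite !mulrA.
  by rewrite gE hE !linearZ /=; congr (_ + _); apply: mulrC.
- rewrite /g /h /= ee ey ye mul0r linear0 lamy; apply/eqP; exact: oner_neq0.
split=> [|chi [chi1 chiM] chi0]; first by rewrite /u /= ey yf lamy.
by rewrite yE !chiM [chi e * _]mulrC -mulrA -chiM ef0 chi0 mulr0.
Qed.

End Peirce.

(** * Existence of noncentral idempotents *)

Lemma falg_mulr1C (F : fieldType) (A : falgType F) (a b : A) :
  a * b = 1 -> b * a = 1.
Proof.
move=> ab; have /lker0_limgf imb : lker (amull b) == 0%VS.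
  by apply/lker0P => u v; rewrite !lfunE /= => /(congr1 ( *%R a));
    rewrite !mulrA ab !mul1r.
have /memv_imgP[v _] : 1 \in limg (amull b) by rewrite imb memvf.
rewrite lfunE /= => bv; have av : a = v by rewrite -[v]mul1r -ab -mulrA -bv
  mulr1.
by rewrite av -bv.
Qed.

Definition noncentral_idempotent (R : pzRingType) (e : R) :=
  e * e = e /\ exists c, e * c <> c * e.

Section NoncentralIdempotent.
Variables (F : finFieldType) (A : falgType F).
Hypothesis dimA : \dim {:A} = 4%N.

(** An idempotent positive power of b still fixes a on the left and kills it on the right, hence
    does not commute with a. *)
Lemma noncentral_idempotent_power (a b : A) :
  b * a = a -> a * b = 0 -> a != 0 -> exists e : A, noncentral_idempotent e.
Proof.
move=> ba ab a0; have [n n0 bn] := idempotent_power b.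
exists (b ^+ n); split=> //; exists a.
have -> : b ^+ n * a = a by elim: n {n0 bn} => [|n IH];
  rewrite ?mul1r // exprSr -mulrA ba.
rewrite -(prednK n0) exprS mulrA ab mul0r; exact/eqP.
Qed.

Lemma noncentral_idempotent_power' (a b : A) :
  a * b = a -> b * a = 0 -> a != 0 -> exists e : A, noncentral_idempotent e.
Proof.
move=> ba ab a0; have [n n0 bn] := idempotent_power b.
exists (b ^+ n); split=> //; exists a.
have -> : a * b ^+ n = a by elim: n {n0 bn} => [|n IH];
  rewrite ?mulr1 // exprS mulrA ba.
rewrite -(prednK n0) exprSr -mulrA ab mulr0 => /esym; exact/eqP.
Qed.

Variable i : A.
Hypotheses (ii : i * i = i) (i_neq1 : i != 1) (iC : forall c, i * c = c * i).

(** Adding the complement 1 - i turns a one-sided inverse in the corner iA into one in A, where it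
    is two-sided by finite dimension. *)
Lemma corner_mulr1C (k : F) a b : i * a = a -> i * b = b -> k != 0 ->
  a * b = k *: i -> b * a = a * b.
Proof.
move=> ia ib k0 ab; have [j jE] : exists j, j = 1 - i by exists (1 - i).
have ij : i * j = 0 by rewrite jE mulrBr mulr1 ii subrr.
have ji : j * i = 0 by rewrite -iC.
have jj : j * j = j by rewrite {1}jE mulrBl mul1r ij subr0.
have [aj bj] : a * j = 0 /\ b * j = 0.
  by rewrite -ia -ib [i * a]iC [i * b]iC -!mulrA ij !mulr0.
have [ja jb] : j * a = 0 /\ j * b = 0.
  by rewrite -ia -ib !mulrA ji !mul0r.
have : (k^-1 *: a + j) * (b + j) = 1.
  rewrite mulrDl !mulrDr -!scalerAl ab aj jb jj scaler0 addr0 add0r scalerA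
    mulVf //.
  by rewrite scale1r jE addrC subrK.
move/falg_mulr1C; rewrite mulrDl !mulrDr -!scalerAr bj ja jj addr0 scaler0
  add0r.
move/eqP; rewrite eq_sym -subr_eq jE opprB addrC subrK => /eqP ba.
by rewrite ab [in RHS]ba scalerA mulfV // scale1r.
Qed.

(** Noncommutation makes i, a, b independent; with 1 - i, which lies outside the corner, they fill
    the four dimensions of A. *)
Lemma corner_span a b : i * a = a -> i * b = b -> a * b <> b * a ->
  forall c, i * c = c -> exists k l m : F, c = k *: i + l *: a + m *: b.
Proof.
move=> ia ib ab.
have j0 : 1 - i != 0 by rewrite subr_eq0 eq_sym.
have ji : (1 - i) * i = 0 by rewrite mulrBl mul1r ii subrr.
have ij : i * (1 - i) = 0 by rewrite mulrBr mulr1 ii subrr.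
have jj : (1 - i) * (1 - i) = 1 - i by rewrite {1}mulrBl mul1r ij subr0.
have [ja jb] : (1 - i) * a = 0 /\ (1 - i) * b = 0.
  by rewrite -ia -ib !mulrA ji !mul0r.
have [ai bi] : a * i = a /\ b * i = b by rewrite -!iC.
have dX : free [:: 1 - i; i; a; b].
  apply: free4P => k l m n rel.
  have k0 : k = 0.
    have : (1 - i) * (k *: (1 - i) + l *: i + m *: a + n *: b) = 0
      by rewrite rel mulr0.
    rewrite !mulrDr -!scalerAr ja jb ji jj !scaler0 !addr0 => /eqP.
    by rewrite scaler_eq0 (negPf j0) orbF => /eqP.
  move: rel; rewrite k0 scale0r add0r => rel.
  have n0 : n = 0.
    apply/eqP/negPn/negP => n0; apply: ab; apply: (scalerI n0).
    have /(congr1 ( *%R a)) := rel; have /(congr1 ( *%R^~ a)) := rel.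
    rewrite !mulrDl !mulrDr mulr0 mul0r -!scalerAl -!scalerAr ia ai => <- /eqP.
    by rewrite eq_sym => /eqP/addrI.
  move: rel; rewrite n0 scale0r addr0 => rel.
  have m0 : m = 0.
    apply/eqP/negPn/negP => m0; apply: ab; apply: (scalerI m0).
    have /(congr1 ( *%R b)) := rel; have /(congr1 ( *%R^~ b)) := rel.
    by rewrite !mulrDl !mulrDr mulr0 mul0r -!scalerAl -!scalerAr ib bi => <-
      /addrI->.
  move: rel; rewrite m0 scale0r addr0 => /eqP;
    rewrite scaler_eq0 => /orP[/eqP->|/eqP i0] //.
  by case: ab; rewrite -ia -ib i0 !mul0r.
move=> c ic; have [k [l [m [n cE]]]] := span4P dimA dX c.
exists l, m, n; rewrite -ic cE !mulrDr -!scalerAr ij ii ia ib.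
by rewrite scaler0 add0r.
Qed.

(* After shifting a and b by multiples of i, ab = 0 and                       *)
(* ba = m a + n b - m n i.                                                    *)
Lemma corner_noncentral_idempotent a b :
  i * a = a -> i * b = b -> a * b <> b * a -> exists e : A,
    noncentral_idempotent e.
Proof.
have shift x y k m n : i * x = x -> i * y = y ->
    x * y = k *: i + m *: x + n *: y ->
    (x - n *: i) * (y - m *: i) = (k + m * n) *: i.
  move=> ix iy xy; rewrite mulrBl !mulrBr -!scalerAl -!scalerAr iy -[x * i]iC
    ix ii.
  rewrite opprB addrA addrAC xy [_ + _ *: x + _]addrAC addrK addrK scalerDl.
  by rewrite scalerA [n * m]mulrC.
have comm_shift x y m n : (x - n *: i) * (y - m *: i) = (y - m *: i) * (x - n
  *: i) ->
    x * y = y * x.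
  have comm_i k z : GRing.comm (k *: i) z by rewrite /GRing.comm -scalerAl
    -scalerAr iC.
  move=> XY; rewrite -[x](subrK (n *: i)) -[y](subrK (m *: i)).
  by apply: commrD; apply/commr_sym/commrD => //; apply: commr_sym.
move=> ia ib ab.
have [k [m [n abE]]] := corner_span ia ib ab (c
  := a * b) ltac:(by rewrite mulrA ia).
pose a' := a - n *: i; pose b' := b - m *: i.
have a'b'C : a' * b' <> b' * a' by move/comm_shift.
have [ia' ib'] : i * a' = a' /\ i * b' = b'.
  by rewrite !mulrBr -!scalerAr ii ia ib.
(* The shifted product is a multiple of i; a nonzero multiple would make the two factors commute. *)
have a'b' : a' * b' = 0.
  have := shift _ _ _ _ _ ia ib abE; rewrite -/a' -/b'.
  have [->|k0] := eqVneq (k + m * n) 0; first by rewrite scale0r.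
  by move/(corner_mulr1C ia' ib' k0)/esym.
move: {a b k m n abE ia ib ab} a' b' a'b'C ia' ib' a'b' => a b abC ia ib ab.
have baC : b * a <> a * b by move/esym.
have [k [m [n baE]]] := corner_span ib ia baC (c
  := b * a) ltac:(by rewrite mulrA ib).
(* The same shift applied to ba: its scalar must vanish, for otherwise the shifts of b and a would
   commute. *)
have mn0 : k + m * n = 0.
  apply/eqP/negPn/negP => mn0; apply: baC; apply: (comm_shift _ _ m n).
  by apply/esym/(corner_mulr1C _ _ mn0 (shift _ _ _ _ _ ib ia baE));
    rewrite mulrBr -scalerAr ii ?ia ?ib.
have ba0 : b * a <> 0 by rewrite ab in baC.
have [a0 b0] : a != 0 /\ b != 0.
  by split; apply/eqP => z; case: ba0; rewrite z ?mul0r ?mulr0.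
have kE : k = - (m * n) by apply/eqP; rewrite -addr_eq0 mn0.
(* Multiply the formula for ba by a on the left and use ab = 0; [bb] is the mirror image. *)
have aa : n *: (a * a) = (m * n) *: a.
  have : a * (b * a) = 0 by rewrite mulrA ab mul0r.
  rewrite baE !mulrDr -!scalerAr ab scaler0 addr0 -iC ia kE scaleNr.
  by move/eqP; rewrite addrC subr_eq0 => /eqP.
have bb : m *: (b * b) = (m * n) *: b.
  have : b * a * b = 0 by rewrite -mulrA ab mulr0.
  rewrite baE !mulrDl -!scalerAl ab scaler0 addr0 ib kE scaleNr.
  by move/eqP; rewrite addrC subr_eq0 => /eqP.
(* If n = 0 then ba = mb, and if m = 0 then ba = na, so a power of a rescaled factor works. If
   neither vanishes, a^2 = ma and a/m is itself idempotent. *)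
have [n0 | n0] := eqVneq n 0.
  have m0 : m != 0.
    apply/eqP => m0; case: ba0; rewrite baE kE n0 m0.
    by rewrite mulr0 oppr0 !scale0r !addr0.
  apply: (@noncentral_idempotent_power' b (m^-1 *: a)) => //.
    rewrite -scalerAr baE kE n0 mulr0 oppr0 !scale0r add0r addr0 scalerA mulVf
      //.
    by rewrite scale1r.
  by rewrite -scalerAl ab scaler0.
have [m0 | m0] := eqVneq m 0.
  apply: (@noncentral_idempotent_power a (n^-1 *: b)) => //.
    rewrite -scalerAl baE kE m0 mul0r oppr0 !scale0r !add0r scalerA mulVf //.
    by rewrite scale1r.
  by rewrite -scalerAr ab scaler0.
exists (m^-1 *: a); split; last first.
  by exists b => /eqP; rewrite -scalerAl -scalerAr ab scaler0 eq_sym scaler_eq0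
    invr_eq0 (negPf m0) => /eqP.
rewrite -scalerAl -scalerAr; congr (_ *: _).
apply: (scalerI m0); rewrite scalerA mulfV // scale1r; apply: (scalerI n0).
by rewrite aa mulrC scalerA.
Qed.

End NoncentralIdempotent.

Lemma characterX (F : fieldType) (A : falgType F) (g : A -> F) a n :
  character g -> g (a ^+ n) = g a ^+ n.
Proof.
by case=> g1 gM; elim: n => [|n IHn]; rewrite ?expr0 // !exprS gM IHn.
Qed.

(** The alternative is whether the kernel of eps contains a nonzero idempotent. The condition on y
    says that u is not a combination of characters. *)
Lemma noncommutative_dichotomy (F : finFieldType) (A : falgType F)
    (eps : {linear A -> F^o}) :
  \dim {:A} = 4%N -> noncommutative A -> character eps ->
  (exists (p q : {linear A -> F^o}) (a b : A),
    [/\ skew_derivation eps eps p, skew_derivation eps eps q,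
        eps a = 0 /\ eps b = 0 &
        [/\ p a = 1, p b = 0, q a = 0 & q b = 1]]) \/
  (exists (g h u : {linear A -> F^o}) (y : A),
    [/\ character g, character h, skew_derivation g h u, exists e, g e <> h e &
        u y = 1 /\
        forall chi : A -> F, character chi -> chi 0 = 0 -> chi y = 0]).
Proof.
move=> dimA ncA epsP; have [eps1 epsM] := epsP.
have [/existsP[e /and3P[/eqP eps_e /eqP ee e0]] | nil] :=
  boolP [exists e : finvect_type A, [&& eps e == 0,
    (e : A) * e == e & (e : A) != 0]];
  [right | left]; last first.
  (* The idempotent power of j lies in the kernel of eps, hence is zero. *)
  apply: nil_derivations => // j eps_j; have [n n0 jn] := idempotent_power j.
  exists n; apply: contraNeq nil => jn0; apply/existsP; exists (j ^+ n).
  rewrite jn0 jn eqxx characterX // eps_j; apply/andP; split=> //.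
  by rewrite expr0n eqn0Ngt n0.
have [e' [e'e' [c e'c]]] : exists e : A, noncentral_idempotent e.
  have [/existsP[c /eqP ec] | /existsPn eC] :=
    boolP [exists c : finvect_type A, (e : A) * c != c * e].
    by exists e; split=> //; exists c.
  have {}eC (c : A) : e * c = c * e by apply/eqP/negPn/eC.
  pose f : A := 1 - e; have fC (c : A) : f * c = c * f
    by rewrite mulrBl mulrBr mul1r mulr1 eC.
  have ff : f * f = f by rewrite {1}/f mulrBl mul1r /f mulrBr mulr1 ee subrr
    subr0.
  have e1 : e != 1 by apply: contra_eqN eps_e => /eqP->; rewrite eps1 oner_eq0.
  have f1 : f != 1 by rewrite /f -subr_eq0 addrAC subrr add0r oppr_eq0.
  (* When e is central, A is the product of the corners eA and fA, and one of them must be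
     noncommutative. *)
  have split_mul (a b : A) : a * b = e * a * (e * b) + f * a * (f * b).
    have cornerM (i : A) : i * i = i -> (forall c,
      i * c = c * i) -> i * a * (i * b) = i * (a * b).
      by move=> ii iC; rewrite -mulrA [a * _]mulrA -iC !mulrA ii.
    by rewrite !cornerM // -mulrDl addrC subrK mul1r.
  have corner (i a b : A) : i * i = i -> i != 1 -> (forall c, i * c = c * i) ->
      i * a * (i * b) <> i * b * (i * a) -> exists e : A,
        noncentral_idempotent e.
    by move=> ii i1 iC ab; apply: (corner_noncentral_idempotent dimA ii i1 iC _
      _ ab); rewrite mulrA ii.
  have [/existsP[[a b] /= /eqP ab] | /existsPn nc] :=
    boolP [exists ab : finvect_type A * finvect_type A,
      (ab.1 : A) * ab.2 != ab.2 * ab.1]; last first.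
    by case: ncA => a b; apply/eqP/negPn; exact: (nc (a, b)).
  have [eab | /eqP] := eqVneq (e * (a : A) * (e * b)) (e * b * (e * a));
    last exact: corner.
  apply: (@corner f a b) => // fab; apply: ab.
  by rewrite [LHS]split_mul [RHS]split_mul eab fab.
(* The two off-diagonal blocks of c cannot both vanish, as then e'c = e'ce' = ce'. *)
have [y0 | y0] := eqVneq (e' * c * (1 - e')) 0.
  have y0' : (1 - e') * c * e' != 0.
    apply/eqP => z0; apply: e'c; move: y0 z0; rewrite mulrBr mulr1 !mulrBl
      mul1r.
    by move=> /subr0_eq ec /subr0_eq ->; exact: ec.
  have ff : (1 - e') * (1 - e') = 1 - e' by rewrite mulrBl mul1r mulrBr mulr1
    e'e' subrr subr0.
  have [g [h [u [y [gP hP uP gh yP]]]]] := peirce_skew_derivation dimA ff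
    (subrK _ _) epsP y0'.
  by exists g, h, u, y; split=> //; exists (1 - e').
have [g [h [u [y [gP hP uP gh yP]]]]] := peirce_skew_derivation dimA e'e'
  (subrKC _ _) epsP y0.
by exists g, h, u, y; split=> //; exists e'.
Qed.

(** * Grouplike and skew-primitive elements *)

Section GrouplikeElements.
Variables (F : fieldType) (H : bialgType F).
Implicit Types (f : conv_alg H) (g h u v : H).

Definition eval_at h f : F^o := f h.

Lemma eval_at_is_linear h : linear (eval_at h).
Proof. by move=> k f f'; rewrite /eval_at add_lfunE scale_lfunE. Qed.

HB.instance Definition _ h := GRing.isLinear.Build F (conv_alg H) F^o _
  (eval_at h) (eval_at_is_linear h).

Lemma conv_algM f f' h : (f * f') h = tensor_eval f f' (comul h).
Proof. exact: convE. Qed.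

(** Biduality in finite dimension, which turns forms on the dual algebra into elements of H. *)
Lemma eval_at_onto (phi : {linear conv_alg H -> F^o}) :
  exists h, forall f, phi f = eval_at h f.
Proof.
exists (\sum_i (phi (dual_vbase i) : F) *: vbase i) => f.
rewrite /eval_at linear_sum {1}(dual_sum (f : dual H)) linear_sum.
by apply: eq_bigr => i _; rewrite !linearZ; apply: mulrC.
Qed.

Lemma tensor_eqP (t t' : tensor H H) :
  (forall f f', tensor_eval f f' t = tensor_eval f f' t') -> t = t'.
Proof.
move=> tt'; apply: tensor_eval_inj => f g.
have fE (k : {linear H -> F^o}) : k =1 (linfun k : conv_alg H).
  by move=> v; rewrite [RHS](lfunE k).
by rewrite !(eq_tensor_eval (fE f) (fE g)).
Qed.

Lemma eval_at_inj g h : (forall f, f g = f h) -> g = h.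
Proof.
move=> gh; rewrite (vcoord_sum g) (vcoord_sum h); apply: eq_bigr => i _.
congr (_ *: _); rewrite -!dual_vbaseE; exact: gh.
Qed.

Definition grouplike g := comul g = tens g g /\ counit g = 1.

Definition skew_primitive g h u := comul u = tens g u + tens u h.

Lemma grouplikeP g : grouplike g <-> character (eval_at g).
Proof.
split=> [[gg g1] | [g1 gM]].
  split=> [|f f']; first by rewrite /eval_at conv1E.
  by rewrite /eval_at conv_algM gg tensor_evalE.
split; last by rewrite -conv1E.
by apply: tensor_eqP => f f'; rewrite -conv_algM tensor_evalE; apply: gM.
Qed.

Lemma skew_primitiveP g h u :
  skew_primitive g h u <-> skew_derivation (eval_at g) (eval_at h) (eval_at u).
Proof.
split=> [uP f f' | uP].
  by rewrite /eval_at conv_algM uP linearD /= !tensor_evalE.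
apply: tensor_eqP => f f'; rewrite -conv_algM linearD /= !tensor_evalE;
  exact: uP.
Qed.

Lemma grouplike1 : grouplike (1 : H).
Proof. by split; [apply: comul1 | apply: counit1]. Qed.

Lemma grouplikeM g h : grouplike g -> grouplike h -> grouplike (g * h).
Proof.
move=> [gg g1] [hh h1]; split; last by rewrite counitM g1 h1 mulr1.
by rewrite comulM gg hh tmul_tens.
Qed.

Lemma grouplike_skewM g h k u : grouplike g -> skew_primitive h k u ->
  skew_primitive (g * h) (g * k) (g * u).
Proof.
by move=> [gg _] uP; rewrite /skew_primitive comulM gg uP tmulDr !tmul_tens.
Qed.

Lemma skew_grouplikeM g h k u : grouplike k -> skew_primitive g h u ->
  skew_primitive (g * k) (h * k) (u * k).
Proof.
by move=> [kk _] uP; rewrite /skew_primitive comulM kk uP tmulDl !tmul_tens.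
Qed.

Lemma conv_skew_square f f' s x : s * s = 1 -> skew_primitive s 1 x ->
  (f * f') (x * x) =
  f 1 * f' (x * x) + f (x * s) * f' x + f (s * x) * f' x + f (x * x) * f' 1.
Proof.
move=> ss xP; rewrite conv_algM comulM xP tmulDr !tmulDl !tmul_tens ss !mulr1
  mul1r.
by rewrite !linearD /= !tensor_evalE !addrA.
Qed.

Lemma conv_grouplike f f' g : grouplike g ->
  (f * f') g = f g * f' g.
Proof. by move=> [gg _]; rewrite conv_algM gg tensor_evalE. Qed.

Lemma conv_skew f f' g h u : skew_primitive g h u ->
  (f * f') u = f g * f' u + f u * f' h.
Proof. by move=> uP; rewrite conv_algM uP linearD /= !tensor_evalE. Qed.

Lemma counit_skew g h u : grouplike g -> grouplike h -> skew_primitive g h u ->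
  counit u = 0.
Proof.
move=> [_ g1] [_ h1] /skew_primitiveP/(_ 1 1).
rewrite mulr1 /eval_at !conv1E g1 h1 mulr1 mul1r.
by rewrite -{1}[counit u]addr0 => /addrI/esym.
Qed.

End GrouplikeElements.

(** * From the dual algebra to grouplike and skew-primitive elements *)

Section Cocommutativity.
Variables (F : fieldType) (H : bialgType F).
Hypothesis dimH : \dim {:H} = 4%N.
Implicit Types (g h u v : H).

Definition cocommutes u := tswap (comul u) = comul u.

Lemma cocommutes_grouplike g : grouplike g -> cocommutes g.
Proof. by move=> [gg _]; rewrite /cocommutes gg tswap_tens. Qed.

Lemma cocommutes_skew g u : skew_primitive g g u -> cocommutes u.
Proof.
by rewrite /cocommutes => ->; rewrite linearD /= !tswap_tens addrC.
Qed.

Lemma cocommutative_of_basis a b c d : free [:: a; b; c; d] ->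
  cocommutes a -> cocommutes b -> cocommutes c -> cocommutes d ->
  forall v, tswap (comul v) = comul v.
Proof.
rewrite /cocommutes => dX ca cb cc cd v.
have [k [l [m [n ->]]]] := span4P dimH dX v.
by rewrite !linearD !linearZ /= ca cb cc cd.
Qed.

Lemma primitives_cocommutative p q (a b : conv_alg H) :
  skew_primitive 1 1 p -> skew_primitive 1 1 q -> a 1 = 0 -> b 1 = 0 ->
  [/\ a p = 1, b p = 0, a q = 0 & b q = 1] ->
  forall v, tswap (comul v) = comul v.
Proof.
move=> pP qP a1 b1 [ap bp aq bq].
have pqE : comul (p * q) = tens 1 (p * q) + tens p q + (tens q p + tens (p * q)
  1).
  by rewrite comulM pP qP tmulDr !tmulDl !tmul_tens !mulr1 !mul1r.
have kill (f : conv_alg H) k l m n : k *: 1 + l *: p + m *: q + n *: (p * q) =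
  0 ->
    k * f 1 + l * f p + m * f q + n * f (p * q) = 0.
  by move=> rel; rewrite -(linear0 f) -rel !linearD !linearZ.
have abE v : (a * b) v = tensor_eval a b (comul v) by apply: conv_algM.
have dX : free [:: 1; p; q; p * q].
  apply: free4P => k l m n rel.
  (* The convolution a * b vanishes at 1, p, q and equals 1 at pq, so it isolates the last
     coefficient. *)
  have := kill (a * b) _ _ _ _ rel; rewrite !abE comul1 pP qP pqE !linearD /=.
  rewrite !tensor_evalE /= a1 b1 ap aq bp bq => n0.
  have {}n0 : n = 0 by rewrite -n0; ring.
  have := kill a _ _ _ _ rel; rewrite n0 a1 ap aq => l0.
  have {}l0 : l = 0 by rewrite -l0; ring.
  have := kill b _ _ _ _ rel; rewrite n0 b1 bp bq => m0.
  have {}m0 : m = 0 by rewrite -m0; ring.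
  move: rel; rewrite l0 m0 n0 !scale0r !addr0 => /eqP.
  by rewrite scaler_eq0 oner_eq0 orbF => /eqP.
apply: (cocommutative_of_basis dX).
- exact/cocommutes_grouplike/grouplike1.
- exact: cocommutes_skew pP.
- exact: cocommutes_skew qP.
rewrite /cocommutes pqE !linearD /= !tswap_tens addrC.
by congr (_ + _); rewrite addrC.
Qed.

End Cocommutativity.

Lemma noncommutative_conv_alg (F : fieldType) (H : bialgType F) :
  noncocommutative H -> noncommutative (conv_alg H).
Proof.
move=> ncH cH; apply: ncH => h; apply: tensor_eqP => f f'.
rewrite -conv_algM cH conv_algM.
elim/tensor_ind: (comul h) => [u v | s t Ps Pt].
  by rewrite tswap_tens !tensor_evalE mulrC.
by rewrite !linearD /= Ps Pt.
Qed.

Lemma dim_conv_alg (F : fieldType) (H : bialgType F) :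
  \dim {:conv_alg H} = \dim {:H}.
Proof. by rewrite !dimvf; apply: muln1. Qed.

Lemma F2P (v : 'F_2) : v = 0 \/ v = 1.
Proof. by case: v => [[|[|//]]] lt; [left | right]; apply: val_inj. Qed.

(** The nil case is excluded by cocommutativity. The form phi witnesses that u lies outside the span
    of the grouplikes. *)
Lemma hopf_dichotomy (H : bialgType 'F_2) : \dim {:H} = 4%N -> noncocommutative
  H ->
  exists (g h u : H) (phi : conv_alg H),
    [/\ grouplike g, grouplike h, g <> h, skew_primitive g h u & phi u = 1 /\
        forall t, grouplike t -> phi t = 0].
Proof.
move=> dimH ncH; have dimA : \dim {:conv_alg H} = 4%N by rewrite dim_conv_alg.
have eps : character (eval_at (1 : H)) by apply/grouplikeP/grouplike1.
have [[p [q [a [b [pP qP [a1 b1] [pa pb qa qb]]]]]] | ] :=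
  noncommutative_dichotomy dimA (noncommutative_conv_alg ncH) eps.
  have [[p' p'E] [q' q'E]] := (eval_at_onto p, eval_at_onto q).
  case: ncH; apply: (@primitives_cocommutative _ _ dimH p' q' a b) => //.
  - by apply/skew_primitiveP => f f'; rewrite -!p'E; apply: pP.
  - by apply/skew_primitiveP => f f'; rewrite -!q'E; apply: qP.
  - by move: pa pb qa qb; rewrite !p'E !q'E; split.
move=> [g [h [u [y [gP hP uP [e gh] [uy charsy]]]]]].
have [[g' g'E] [h' h'E] [u' u'E]] := And3 (eval_at_onto g) (eval_at_onto h)
  (eval_at_onto u).
exists g', h', u', y; split.
- apply/grouplikeP; case: gP => g1 gM; split=> [|f f']; by rewrite -!g'E.
- apply/grouplikeP; case: hP => h1 hM; split=> [|f f']; by rewrite -!h'E.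
- by move=> gh'; apply: gh; rewrite g'E h'E gh'.
- by apply/skew_primitiveP => f f'; rewrite -!u'E -!g'E -!h'E; apply: uP.
split=> [|t /grouplikeP tP]; first by rewrite -[LHS]/(eval_at u' y) -u'E.
by apply: (charsy _ tP); rewrite linear0.
Qed.

Lemma addF2 (a b : 'F_2) : a + b = 0 -> a = b.
Proof.
by move/eqP; rewrite addr_eq0 => /eqP->; have [->|->] := F2P b; apply: val_inj.
Qed.

Lemma addF2v (V : lmodType 'F_2) (v : V) : v + v = 0.
Proof.
by rewrite -[v]scale1r -scalerDl (_ : 1 + 1 = 0) ?scale0r //; apply: val_inj.
Qed.

Section AntipodeIdentities.
Variables (F : fieldType) (H : hopfAlgType F).
Implicit Types (g h u : H).

Lemma antipode_grouplike g :
  grouplike g -> antipode g * g = 1 /\ g * antipode g = 1.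
Proof.
move=> [gg g1]; have := antipodel g; have := antipoder g.
by rewrite gg g1 scale1r tlift_mull tlift_mulr.
Qed.

Lemma antipode_skew g h u : skew_primitive g h u ->
  antipode g * u + antipode u * h = (counit u)%:A.
Proof.
by move=> uP; rewrite -antipodel uP linearD /= !tlift_mull.
Qed.

End AntipodeIdentities.

(** An invertible idempotent is 1, so some positive power of s is 1 and the inverse is again a power
    of s, visibly grouplike. *)
Lemma grouplike_inverse (F : finFieldType) (H : hopfAlgType F) (s : H) :
  grouplike s -> exists s', grouplike s' /\ s' * s = 1.
Proof.
move=> sP; have [Ss _] := antipode_grouplike sP.
have [n n0 sn] := idempotent_power s.
have cancel m (v : H) : antipode s ^+ m * (s ^+ m * v) = v.
  elim: m => [|m IHm]; first by rewrite !mul1r.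
  by rewrite exprSr exprS -!mulrA [antipode s * _]mulrA Ss mul1r IHm.
have {}sn : s ^+ n = 1 by rewrite -[LHS](cancel n) sn -[X in _ * X]mulr1 cancel.
exists (s ^+ n.-1); split; last by rewrite -exprSr prednK.
by elim: n.-1 => [|m IHm]; [apply: grouplike1 | rewrite exprS;
  apply: grouplikeM].
Qed.

Lemma dual_of_free4 (F : fieldType) (H : bialgType F) (a b c d : H) k l m n :
  free [:: a; b; c; d] ->
  exists f : conv_alg H, [/\ f a = k, f b = l, f c = m & f d = n].
Proof.
move=> dX; have [f fE] :=
  linear_of_free [:: a; b; c; d] ([:: k; l; m; n] : seq F^o).
exists (linfun f); have [<- <- <- <-] := fE dX erefl.
by split; exact: (lfunE f).
Qed.

(** * The grouplikes 1 and s and a skew-primitive basis *)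

Section TwoGrouplikes.
Variable H : hopfAlgType 'F_2.
Hypothesis dimH : \dim {:H} = 4%N.
Variables (s g h u : H) (phi : conv_alg H).
Hypotheses (sP : grouplike s) (gP : grouplike g) (hP : grouplike h).
Hypotheses (s1 : s <> 1) (uP : skew_primitive g h u) (phiu : phi u = 1).
Hypothesis phi0 : forall t, grouplike t -> phi t = 0.

Lemma grouplike_mul_neq t : grouplike t -> s * t <> t.
Proof.
move=> tP st; apply: s1; have [_ tt] := antipode_grouplike tP.
by rewrite -[s]mulr1 -tt mulrA st.
Qed.

(* Evaluate f * phi on the relation, then phi on its translate by s^-1.       *)
Lemma skew_translate_relation t k l m n o : grouplike t ->
  k *: 1 + l *: s + m *: t + n *: u + o *: (s * u) = 0 -> n = 0 /\ o = 0.
Proof.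
move=> tP rel.
have eval (f : conv_alg H) :
    k * f 1 + l * f s + m * f t + n * f u + o * f (s * u) = 0.
  by rewrite -(linear0 f) -rel !linearD !linearZ.
have phi_t f v : grouplike v -> (f * phi : conv_alg H) v = 0.
  by move=> vP; rewrite conv_algM vP.1 tensor_evalE /= phi0 // mulr0.
have phi_u f g' h' v : grouplike h' -> skew_primitive g' h' v ->
    (f * phi : conv_alg H) v = f g' * phi v.
  by move=> h'P vP; rewrite conv_algM vP linearD /= !tensor_evalE /= (phi0 h'P)
    mulr0 addr0.
have rel' (f : conv_alg H) : n * f g + o * phi (s * u) * f (s * g) = 0.
  have := eval (f * phi).
  rewrite (phi_t _ _ (grouplike1 H)) (phi_t _ _ sP) (phi_t _ _ tP).
  rewrite (phi_u _ _ _ _ hP uP) (phi_u _ _ _ _ (grouplikeM sP hP)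
    (grouplike_skewM sP uP)).
  by rewrite phiu => <-; ring.
(* If n = 1, taking f to be the counit forces the other coefficient of [rel'] to be 1; then every f
   agrees at g and sg, so sg = g. *)
have n0 : n = 0.
  have [//|n1] := F2P n; case: (grouplike_mul_neq gP); apply: eval_at_inj => f.
  have := rel' 1; rewrite !conv1E counitM sP.2 gP.2 n1.
  have [-> /eqP|ophi _] := F2P (o * phi (s * u)).
    by rewrite mul0r addr0 mulr1 oner_eq0.
  by have := rel' f; rewrite n1 ophi !mul1r => /addF2->.
split=> //; move: rel; rewrite n0 scale0r addr0.
have [s' [s'P s's]] := grouplike_inverse sP.
move=> /(congr1 ( *%R s'))/(congr1 phi).
rewrite mulr0 linear0 !mulrDr -!scalerAr mulr1 s's mulrA s's mul1r !linearD
  !linearZ /=.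
rewrite phiu (phi0 s'P) (phi0 (grouplikeM s'P tP)) (phi0 (grouplike1 H)).
by move=> <-; rewrite !scaler0 !add0r [_ *: _]mulr1.
Qed.

Lemma skew_translate_free : free [:: 1; s; u; s * u].
Proof.
apply: free4P => k l n o rel.
have [n0 o0] : n = 0 /\ o = 0.
  apply: (@skew_translate_relation 1 k l 0 n o); first exact: grouplike1.
  by rewrite scale0r addr0.
move: rel; rewrite n0 o0 !scale0r !addr0 => rel.
have kl : k = l.
  have /(congr1 counit) := rel; rewrite linearD !linearZ /= counit1 sP.2
    linear0.
  by rewrite !mulr1 => /addF2.
have [k0|k1] := F2P k; first by rewrite -kl k0.
case: s1; move: rel; rewrite -kl k1 !scale1r.
by move=> rel; apply: (addrI 1); rewrite rel addF2v.
Qed.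

(** The translate relation removes u and su from the expansion of t, and the counit then allows
    exactly one of the coefficients of 1 and s to be 1. *)
Lemma grouplike_two t : grouplike t -> t = 1 \/ t = s.
Proof.
move=> tP; have [k [l [m [n tE]]]] := span4P dimH skew_translate_free t.
have [m0 n0] : m = 0 /\ n = 0.
  apply: (@skew_translate_relation t k l (- 1) m n) => //.
  by rewrite scaleN1r [_ - t + _]addrAC [_ - t + _]addrAC -tE subrr.
move: tE; rewrite m0 n0 !scale0r !addr0 => tE.
have : counit t = k + l by rewrite tE linearD !linearZ /= counit1 sP.2 !mulr1.
rewrite tP.2 tE; have [->|->] := F2P k; have [->|->] := F2P l => //.
- by right; rewrite scale0r scale1r add0r.
- by left; rewrite scale0r scale1r addr0.
Qed.

Lemma grouplike_involution : s * s = 1.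
Proof.
by have [//|/(grouplike_mul_neq sP)] := grouplike_two (grouplikeM sP sP).
Qed.

(** If g = h, all four basis elements would cocommute. So g and h are 1 and s in some order, and
    replacing u by su exchanges the two orders. *)
Lemma skew_basis : noncocommutative H ->
  exists x, skew_primitive s 1 x /\ free [:: 1; s; x; s * x].
Proof.
move=> ncH; have ss := grouplike_involution.
have gh : g <> h.
  move=> gh; have uPg : skew_primitive g g u by have := uP; rewrite -gh.
  apply: ncH; apply: (cocommutative_of_basis dimH skew_translate_free).
  - exact/cocommutes_grouplike/grouplike1.
  - exact: cocommutes_grouplike.
  - exact: cocommutes_skew uPg.
  - exact: cocommutes_skew (grouplike_skewM sP uPg).
have [g1|gs] := grouplike_two gP; have [h1|hs] := grouplike_two hP.
- by case: gh; rewrite g1 h1.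
- exists (s * u); split.
    have := grouplike_skewM sP uP; by rewrite g1 hs mulr1 ss.
  rewrite mulrA ss mul1r (perm_free (Y := [:: 1; s; u; s * u]));
    first exact: skew_translate_free.
  by rewrite !perm_cons; apply/permPl/(perm_catC [:: s * u] [:: u]).
- exists u; split; last exact: skew_translate_free.
  by rewrite -h1 -gs.
- by case: gh; rewrite gs hs.
Qed.

End TwoGrouplikes.

Definition hopf_table (F : fieldType) (H : hopfAlgType F) (s x w : H) :=
  basis_of fullv [:: 1; s; x; w] /\
  [/\ s * s = 1,
      [/\ s * x = w, w * x = w & w * w = w],
      x * s = 1 + s + w,
      w * s = 1 + s + x
    & [/\ s * w = x, x * w = x & x * x = x]] /\
  [/\ comul s = tens s s,
      comul x = tens s x + tens x 1
    & comul w = tens 1 w + tens w s] /\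
  [/\ counit s = 1, counit x = 0 & counit w = 0] /\
  [/\ antipode s = s, antipode x = w & antipode w = 1 + s + x].

Lemma F2_two_eq0 : 2%:R = 0 :> 'F_2.
Proof. exact: val_inj. Qed.

Lemma linear_comb4 (F : fieldType) (V W : lmodType F) (f : {linear V -> W})
    a b c d k l m n :
  f (k *: a + l *: b + m *: c + n *: d) =
  k *: f a + l *: f b + m *: f c + n *: f d.
Proof. by rewrite !linearD !linearZ. Qed.

(** * The structure constants are forced *)

Section Table.
Variable H : hopfAlgType 'F_2.
Hypotheses (dimH : \dim {:H} = 4%N) (ncH : noncommutative H).
Variables s x : H.
Hypotheses (sP : grouplike s) (ss : s * s = 1) (xP : skew_primitive s 1 x).
Hypothesis dX : free [:: 1; s; x; s * x].

Lemma skew_primitive_translate : skew_primitive (1 : H) s (s * x).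
Proof. by have := grouplike_skewM sP xP; rewrite ss mulr1. Qed.

Let wP := skew_primitive_translate.

Lemma conv_comb (f f' : conv_alg H) k l m n :
  (f * f') (k *: 1 + l *: s + m *: x + n *: (s * x)) =
  k * (f 1 * f' 1) + l * (f s * f' s) + m * (f s * f' x + f x * f' 1)
  + n * (f 1 * f' (s * x) + f (s * x) * f' s).
Proof.
rewrite !linear_comb4 /= (conv_skew _ _ xP) (conv_skew _ _ wP).
by rewrite (conv_grouplike _ _ sP) (conv_grouplike _ _ (grouplike1 H)).
Qed.

Lemma counit_comb k l m n :
  counit (k *: 1 + l *: s + m *: x + n *: (s * x)) = k + l.
Proof.
rewrite !linearD !linearZ /= counit1 sP.2.
rewrite (counit_skew sP (grouplike1 H) xP) (counit_skew (grouplike1 H) sP wP).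
by rewrite !mulr1 !mulr0 !addr0.
Qed.

(** Evaluating both forms of the coproduct of v at products of coordinate forms compares their
    coefficients. *)
Lemma skew_primitive_1s v : skew_primitive (1 : H) s v ->
  exists k n, v = k *: (1 + s) + n *: (s * x).
Proof.
move=> vP; have [k [l [m [n vE]]]] := span4P dimH dX v.
have [f1 [f11 f1s f1x f1w]] := @dual_of_free4 _ H _ _ _ _ 1 0 0 0 dX.
have [fx [fx1 fxs fxx fxw]] := @dual_of_free4 _ H _ _ _ _ 0 0 1 0 dX.
have kl : k = l.
  by apply: addF2; rewrite -(counit_comb k l m n) -vE (counit_skew (grouplike1
    H) sP vP).
have m0 : m = 0.
  have := conv_comb f1 fx k l m n.
  rewrite -vE (conv_skew _ _ vP) f11 fx1 f1s fxs f1x fxx fxw f1w.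
  have -> : fx v = m by rewrite vE !linearD !linearZ /= fx1 fxs fxx fxw
    /GRing.scale /=; ring.
  by move=> m0; transitivity (1 * m + f1 v * 0); [ring | rewrite m0; ring].
by exists k, n; rewrite vE -kl m0 scale0r addr0 scalerDr.
Qed.

Lemma primitive_eq0 v : skew_primitive (1 : H) 1 v -> v = 0.
Proof.
move=> vP; have [k [l [m [n vE]]]] := span4P dimH dX v.
have [f1 [f11 f1s f1x f1w]] := @dual_of_free4 _ H _ _ _ _ 1 0 0 0 dX.
have [fs [fs1 fss fsx fsw]] := @dual_of_free4 _ H _ _ _ _ 0 1 0 0 dX.
have [fx [fx1 fxs fxx fxw]] := @dual_of_free4 _ H _ _ _ _ 0 0 1 0 dX.
have [fw [fw1 fws fwx fww]] := @dual_of_free4 _ H _ _ _ _ 0 0 0 1 dX.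
have m0 : m = 0.
  have := conv_comb f1 fx k l m n.
  rewrite -vE (conv_skew _ _ vP) f11 fx1 f1s fxs f1x fxx fxw f1w.
  have -> : fx v = m by rewrite vE !linearD !linearZ /= fx1 fxs fxx fxw
    /GRing.scale /=; ring.
  by move=> m0; transitivity (1 * m + f1 v * 0); [ring | rewrite m0; ring].
have n0 : n = 0.
  have := conv_comb fw f1 k l m n.
  rewrite -vE (conv_skew _ _ vP) f11 fw1 f1s fws f1x fwx fww f1w.
  have -> : fw v = n by rewrite vE !linearD !linearZ /= fw1 fws fwx fww
    /GRing.scale /=; ring.
  by move=> n0; transitivity (0 * f1 v + n * 1); [ring | rewrite n0; ring].
have l0 : l = 0.
  have := conv_comb fs fs k l m n.
  rewrite -vE (conv_skew _ _ vP) fs1 fss fsx fsw.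
  by move=> l0; transitivity (0 * fs v + fs v * 0); [rewrite l0; ring | ring].
have k0 : k = 0.
  have := counit_comb k l m n.
  by rewrite -vE (counit_skew (grouplike1 H) (grouplike1 H) vP) l0 addr0.
by rewrite vE k0 l0 m0 n0 !scale0r !addr0.
Qed.

(** Since xs is (1,s)-skew-primitive, xs = k(1 + s) + n(sx). If n = 0, then x would be a combination
    of 1 and s; if n = 1 and k = 0, then s and x would commute, and so would all of H. *)
Lemma mulxs : x * s = 1 + s + s * x.
Proof.
have [k [n xsE]] : exists k n, x * s = k *: (1 + s) + n *: (s * x).
  apply: skew_primitive_1s.
  by have := skew_grouplikeM sP xP; rewrite ss mul1r.
have [f [f1 fs fx _]] := @dual_of_free4 _ H _ _ _ _ 0 0 1 0 dX.
move: xsE; have [-> | ->] := F2P n; last first.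
  have [-> | ->] := F2P k; rewrite ?scale0r ?scale1r ?add0r // => xs.
  have comm_gen v u : GRing.comm u s -> GRing.comm u x -> GRing.comm u v.
    move=> us ux; have [k' [l [m [o ->]]]] := span4P dimH dX v.
    have commZ c y : GRing.comm u y -> GRing.comm u (c *: y).
      by rewrite /GRing.comm -scalerAl -scalerAr => ->.
    apply: commrD; last exact/commZ/commrM.
    apply: commrD; last exact: commZ.
    by apply: commrD; apply: commZ => //; apply: commr1.
  case: ncH => u v; apply: (comm_gen v u); apply/commr_sym/(comm_gen u _) => //.
rewrite scale0r addr0 => /(congr1 ( *%R^~ s))/(congr1 f).
rewrite -mulrA ss mulr1 fx -scalerAl mulrDl ss mul1r linearZ /= linearD /= fs
  f1 addr0 scaler0.
by move/eqP; rewrite oner_eq0.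
Qed.

(** In the coproduct of x^2 the cross term is (xs + sx) (x) x = (1 + s) (x) x; adding the coproduct
    of x cancels s (x) x, so x^2 + x is primitive and hence zero. *)
Lemma mulxx : x * x = x.
Proof.
apply: (addIr x); rewrite addF2v; apply: primitive_eq0.
apply/skew_primitiveP => f f'; rewrite /eval_at.
have fD (k : conv_alg H) u v : k (u + v) = k u + k v by exact: linearD.
rewrite fD (conv_skew_square _ _ ss xP) (conv_skew _ _ xP) mulxs !fD;
  ring: F2_two_eq0.
Qed.

Lemma table_of_skew_basis : hopf_table s x (s * x).
Proof.
have xs := mulxs; have xx := mulxx.
have sw : s * (s * x) = x by rewrite mulrA ss mul1r.
have wx : s * x * x = s * x by rewrite -mulrA xx.
have ws : s * x * s = 1 + s + x.
  by rewrite -mulrA xs !mulrDr mulr1 ss sw [s + 1]addrC.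
have xw : x * (s * x) = x.
  by rewrite mulrA xs !mulrDl mul1r wx -addrA addF2v addr0.
have ww : s * x * (s * x) = s * x by rewrite -mulrA xw.
have [Ss _] := antipode_grouplike sP.
have antis : antipode s = s by rewrite -[LHS]mulr1 -ss mulrA Ss mul1r.
(* The antipode is solved from its defining identity on skew-primitives, with signs irrelevant in
   characteristic 2. *)
have antix : antipode x = s * x.
  have := antipode_skew xP; rewrite antis mulr1 (counit_skew sP (grouplike1 H)
    xP) scale0r.
  by move=> e; rewrite -[LHS]add0r -(addF2v (s * x)) -addrA e addr0.
have antiw : antipode (s * x) = 1 + s + x.
  have := antipode_skew wP.
  have [a1 _] := antipode_grouplike (grouplike1 H); rewrite mulr1 in a1.
  rewrite a1 mul1r (counit_skew (grouplike1 H) sP wP) scale0r => /eqP.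
  rewrite addrC addr_eq0 => /eqP/(congr1 ( *%R^~ s)).
  rewrite -mulrA ss mulr1 => ->; rewrite mulNr ws.
  by apply/eqP; rewrite eq_sym -addr_eq0 addF2v.
split; first by rewrite basisEfree dX subvf dimH.
split; first by split.
split; first by split; [apply: sP.1 | apply: xP | apply: wP].
split; last by [].
split; [apply: sP.2 | apply: counit_skew xP | apply: counit_skew wP] => //;
  apply: grouplike1.
Qed.

End Table.

Lemma hopf_table_exists (H : hopfAlgType 'F_2) :
  \dim {:H} = 4%N -> noncommutative H -> noncocommutative H ->
  exists s x w : H, hopf_table s x w.
Proof.
move=> dimH ncH nccH.
have [g [h [u [phi [gP hP gh uP [phiu phi0]]]]]] := hopf_dichotomy dimH nccH.
have [s [sP s1]] : exists s : H, grouplike s /\ s <> 1.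
  have [g1 | /eqP g1] := eqVneq g 1; last by exists g.
  by exists h; split=> // h1; apply: gh; rewrite g1 h1.
have [x [xP dX]] := skew_basis dimH sP gP hP s1 uP phiu phi0 nccH.
exists s, x, (s * x); apply: table_of_skew_basis => //.
exact: (grouplike_involution dimH sP gP hP s1 uP phiu phi0).
Qed.

(** * The Hopf algebra structure on NF *)

Lemma basis4_ind (F : fieldType) (V : vectType F) (P : V -> Prop) a b c d :
  basis_of fullv [:: a; b; c; d] ->
  (forall k u, P u -> P (k *: u)) -> (forall u v, P u -> P v -> P (u + v)) ->
  P a -> P b -> P c -> P d -> forall v, P v.
Proof.
move=> /andP[/eqP aV dX] PZ PD Pa Pb Pc Pd v.
have dimV : \dim {:V} = 4%N by rewrite -aV (eqP dX).
have [k [l [m [n ->]]]] := span4P dimV dX v.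
by do 3?[apply: (PD _ _); last exact: (PZ _ _)]; apply: (PZ _ _).
Qed.

Section HopfAxioms.
Variables (F : fieldType) (A : falgType F).
Hypothesis two0 : 2%:R = 0 :> F.
Variables s x w : A.
Hypothesis sxw_basis : basis_of fullv [:: 1; s; x; w].
Hypothesis sxw_mul :
  [/\ s * s = 1,
      [/\ s * x = w, w * x = w & w * w = w],
      x * s = 1 + s + w,
      w * s = 1 + s + x
    & [/\ s * w = x, x * w = x & x * x = x]].
Variable D : {linear A -> tensor A A}.
Hypothesis D1 : D 1 = tens 1 1.
Hypothesis Ds : D s = tens s s.
Hypothesis Dx : D x = tens s x + tens x 1.
Hypothesis Dw : D w = tens 1 w + tens w s.
Variable E : {scalar A}.
Hypotheses (E1 : E 1 = 1) (Es : E s = 1) (Ex : E x = 0) (Ew : E w = 0).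
Variable S : {linear A -> A}.
Hypotheses (S1 : S 1 = 1) (Ss : S s = s) (Sx : S x = w) (Sw : S w = 1 + s + x).

Let sxw_ind P := @basis4_ind F A P 1 s x w sxw_basis.

Let addvv (V : lmodType F) (v : V) : v + v = 0.
Proof. by rewrite -mulr2n -scaler_nat two0 scale0r. Qed.

Lemma sxw_comulA c : tassoc (tmap D idfun (D c)) = tmap idfun D (D c).
Proof.
elim/sxw_ind: c => [k u Pu|u v Pu Pv||||].
- by rewrite !linearZ /= Pu.
- by rewrite !linearD /= Pu Pv.
- by rewrite D1 !tmap_tens /= D1 tassoc_tens.
- by rewrite Ds !tmap_tens /= Ds tassoc_tens.
- rewrite Dx !linearD /= !tmap_tens /= Dx D1 Ds tensDl tensDr !linearD /=.
  by rewrite !tassoc_tens addrA.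
- rewrite Dw !linearD /= !tmap_tens /= Dw D1 Ds tensDl tensDr !linearD /=.
  by rewrite !tassoc_tens addrA.
Qed.

Lemma sxw_counitl c : tlift (fun a b => E a *: b) (D c) = c.
Proof.
elim/sxw_ind: c => [k u Pu|u v Pu Pv||||].
- by rewrite !linearZ /= Pu.
- by rewrite !linearD /= Pu Pv.
- by rewrite D1 tlift_scalel E1 scale1r.
- by rewrite Ds tlift_scalel Es scale1r.
- by rewrite Dx linearD /= !tlift_scalel Es Ex scale1r scale0r addr0.
- by rewrite Dw linearD /= !tlift_scalel E1 Ew scale1r scale0r addr0.
Qed.

Lemma sxw_counitr c : tlift (fun a b => E b *: a) (D c) = c.
Proof.
elim/sxw_ind: c => [k u Pu|u v Pu Pv||||].
- by rewrite !linearZ /= Pu.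
- by rewrite !linearD /= Pu Pv.
- by rewrite D1 tlift_scaler E1 scale1r.
- by rewrite Ds tlift_scaler Es scale1r.
- by rewrite Dx linearD /= !tlift_scaler E1 Ex scale1r scale0r add0r.
- by rewrite Dw linearD /= !tlift_scaler Es Ew scale1r scale0r add0r.
Qed.

(** Bilinearity leaves the sixteen products of basis elements; pairing with arbitrary f and g turns
    each tensor identity into a scalar one in characteristic 2. *)
Lemma sxw_comulM a b : D (a * b) = tmul (D a) (D b).
Proof.
have [ss [sx wx ww] xs ws [sw xw xx]] := sxw_mul.
have T := (ss, sx, wx, ww, xs, ws, sw, xw, xx, mul1r, mulr1).
have DE := (D1, Ds, Dx, Dw).
elim/sxw_ind: a => [k u Pu|u v Pu Pv||||].
- by rewrite -scalerAl !linearZ /= tmulZl Pu.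
- by rewrite mulrDl !linearD /= tmulDl Pu Pv.
all: elim/sxw_ind: b => [k u Pu|u v Pu Pv||||];
  [ by rewrite -scalerAr !linearZ /= tmulZr Pu
  | by rewrite mulrDr !linearD /= tmulDr Pu Pv
  | rewrite !T !DE .. ].
all: rewrite ?linearD /= ?DE ?tmulDr ?tmulDl ?tmul_tens ?T.
all: apply: tensor_eval_inj => f g; rewrite ?linearD /= ?tensor_evalE ?linearD
  /=.
all: by ring: two0.
Qed.

Lemma sxw_counitM a b : E (a * b) = E a * E b.
Proof.
have [ss [sx wx ww] xs ws [sw xw xx]] := sxw_mul.
have T := (ss, sx, wx, ww, xs, ws, sw, xw, xx, mul1r, mulr1).
elim/sxw_ind: a => [k u Pu|u v Pu Pv||||].
- by rewrite -scalerAl !linearZ /= Pu mulrA.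
- by rewrite mulrDl !linearD /= Pu Pv mulrDl.
all: elim/sxw_ind: b => [k u Pu|u v Pu Pv||||];
  [ by rewrite -scalerAr !linearZ /= Pu mulrCA
  | by rewrite mulrDr !linearD /= Pu Pv mulrDr
  | rewrite !T ?linearD /= ?(E1, Es, Ex, Ew); ring: two0 .. ].
Qed.

Lemma sxw_antipodel a : tlift (fun b c : A => S b * c) (D a) = (E a)%:A.
Proof.
have [ss [sx wx ww] xs ws [sw xw xx]] := sxw_mul.
elim/sxw_ind: a => [k u Pu|u v Pu Pv||||].
- by rewrite !linearZ /= Pu scalerA.
- by rewrite !linearD /= Pu Pv scalerDl.
- by rewrite D1 tlift_mull S1 E1 mulr1 scale1r.
- by rewrite Ds tlift_mull Ss Es ss scale1r.
- by rewrite Dx linearD /= !tlift_mull Ss Sx Ex sx mulr1 addvv scale0r.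
- rewrite Dw linearD /= !tlift_mull S1 Sw Ew !mulrDl ss xs !mul1r scale0r.
  by rewrite [s + 1]addrC [1 + s + (_ + _)]addrA addvv add0r addvv.
Qed.

Lemma sxw_antipoder a : tlift (fun b c : A => b * S c) (D a) = (E a)%:A.
Proof.
have [ss [sx wx ww] xs ws [sw xw xx]] := sxw_mul.
elim/sxw_ind: a => [k u Pu|u v Pu Pv||||].
- by rewrite !linearZ /= Pu scalerA.
- by rewrite !linearD /= Pu Pv scalerDl.
- by rewrite D1 tlift_mulr S1 E1 mulr1 scale1r.
- by rewrite Ds tlift_mulr Ss Es ss scale1r.
- by rewrite Dx linearD /= !tlift_mulr S1 Sx Ex sw mulr1 addvv scale0r.
- by rewrite Dw linearD /= !tlift_mulr Ss Sw Ew ws mul1r addvv scale0r.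
Qed.

End HopfAxioms.

(** A sigma type rather than an existential, so that structure maps can be defined by projection. *)
Lemma linear_of_basis4 (F : fieldType) (V : vectType F) (W : lmodType F)
    (a b c d : V) (a' b' c' d' : W) : basis_of fullv [:: a; b; c; d] ->
  {f : {linear V -> W} | [/\ f a = a', f b = b', f c = c' & f d = d']}.
Proof.
move=> /basis_free dX; have [f fE] := linear_of_free [:: a; b; c; d] [:: a';
  b'; c'; d'].
by exists f; case: (fE dX erefl).
Qed.

Lemma hopf_isom_of_table (F : fieldType) (K H : hopfAlgType F) (s x w : K) (s'
  x' w' : H) :
  hopf_table s x w -> hopf_table s' x' w' -> hopf_isom K H.
Proof.
case=> [Kb [[ss [sx wx ww] xs ws [sw xw xx]] [[Ds Dx Dw] [[es ex ew] [as_ ax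
  aw]]]]].
case=> [Hb [[ss' [sx' wx' ww'] xs' ws' [sw' xw' xx']] [[Ds' Dx' Dw'] [[es' ex'
  ew'] [as_' ax' aw']]]]].
have [f [f1 fs fx fw]] := linear_of_basis4 1 s' x' w' Kb.
have [g [g1 gs gx gw]] := linear_of_basis4 1 s x w Hb.
pose ind P := @basis4_ind F K P 1 s x w Kb.
pose ind' P := @basis4_ind F H P 1 s' x' w' Hb.
have fE := (f1, fs, fx, fw); have gE := (g1, gs, gx, gw).
have fM a b : f (a * b) = f a * f b.
{ elim/ind: a => [k u Pu|u v Pu Pv||||].
  - by rewrite -scalerAl !linearZ /= Pu scalerAl.
  - by rewrite mulrDl !linearD /= Pu Pv mulrDl.
  all: elim/ind: b => [k u Pu|u v Pu Pv||||];
    [ by rewrite -scalerAr !linearZ /= Pu scalerAr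
    | by rewrite mulrDr !linearD /= Pu Pv mulrDr
    | by rewrite ?(ss, sx, wx, ww, xs, ws, sw, xw, xx, mul1r, mulr1)
        ?(linearD f) ?fE ?(ss', sx', wx', ww', xs', ws', sw', xw', xx', mul1r,
          mulr1) .. ]. }
have fK v : g (f v) = v.
  elim/ind: v => [k u Pu|u v Pu Pv||||];
    [by rewrite !linearZ /= Pu | by rewrite !linearD /= Pu Pv |
      by rewrite fE gE ..].
have gK v : f (g v) = v.
  elim/ind': v => [k u Pu|u v Pu Pv||||];
    [by rewrite !linearZ /= Pu | by rewrite !linearD /= Pu Pv |
      by rewrite gE fE ..].
pose fR : {lrmorphism K -> H} := HB.pack (f : K -> H)
  (GRing.isLinear.Build F K H _ f (linearP f))
  (GRing.isMonoidMorphism.Build K H f (conj f1 fM)).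
exists fR; split.
- by exists g.
- move=> v /=; elim/ind: v => [k u Pu|u v Pu Pv||||].
  + by rewrite !linearZ /= Pu.
  + by rewrite !linearD /= Pu Pv.
  + by rewrite f1 !comul1 tmap_tens /= f1.
  + by rewrite fs Ds' Ds tmap_tens /= fs.
  + by rewrite fx Dx' Dx linearD /= !tmap_tens /= !fE.
  + by rewrite fw Dw' Dw linearD /= !tmap_tens /= !fE.
- move=> v /=; elim/ind: v => [k u Pu|u v Pu Pv||||].
  + by rewrite !linearZ /= Pu.
  + by rewrite !linearD /= Pu Pv.
  + by rewrite f1 !counit1.
  + by rewrite fs es es'.
  + by rewrite fx ex ex'.
  + by rewrite fw ew ew'.
have anti1 (L : hopfAlgType F) : antipode (1 : L) = 1.
  by have [+ _] := antipode_grouplike (grouplike1 L); rewrite mulr1.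
move=> v /=; elim/ind: v => [k u Pu|u v Pu Pv||||].
- by rewrite !linearZ /= Pu.
- by rewrite !linearD /= Pu Pv.
- by rewrite f1 !anti1 f1.
- by rewrite fs as_ as_' fs.
- by rewrite fx ax ax' fw.
- by rewrite fw aw aw' !linearD /= !fE.
Qed.

(** * Self-duality pairings *)

Section Pairing.
Variables (F : fieldType) (H : vectType F) (p : {biscalar H}).

Lemma pairing2_tensE (t : tensor H H) b c :
  pairing2 p t (tens b c) = tensor_eval (fun a => p a b) (fun a => p a c) t.
Proof.
apply: (@eq_tlift F H H F^o _ _ _ t) => u v.
rewrite tlift_tens // => y k z t' /=.
  by rewrite linearPr mulrDl scalerAl.
by rewrite linearPr mulrDr scalerAr.
Qed.

Lemma pairing2Dl s t t' : pairing2 p (s + t) t' = pairing2 p s t' + pairing2 p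
  t t'.
Proof. by rewrite /pairing2 linearD. Qed.

Lemma pairing2Dr t s' t' : pairing2 p t (s' + t') = pairing2 p t s' + pairing2
  p t t'.
Proof.
rewrite -[pairing2 p t s' in RHS]mul1r [RHS](esym (tlift_fun_linear _ _ 1 t)).
by apply: (@eq_tlift F H H F^o _ _ _ t) => a b; rewrite scale1r linearD.
Qed.

Lemma pairing2_tens a b c d : pairing2 p (tens a b) (tens c d) = p a c * p b d.
Proof.
rewrite pairing2_tensE /tensor_eval tlift_tens // => y k z t /=.
  by rewrite linearPl mulrDl scalerAl.
by rewrite linearPl mulrDr scalerAr.
Qed.

Lemma pairing2_symmetric : (forall a b, p a b = p b a) ->
  forall t t', pairing2 p t t' = pairing2 p t' t.
Proof.
move=> pC t t'; elim/tensor_ind: t => [a b | s t Ps Pt]; last first.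
  by rewrite pairing2Dl pairing2Dr Ps Pt.
elim/tensor_ind: t' => [c d | s t Ps Pt]; last
  by rewrite pairing2Dl pairing2Dr Ps Pt.
by rewrite !pairing2_tens [p a c]pC [p b d]pC.
Qed.

End Pairing.

Section DualCoalgebra.
Variables (F : fieldType) (H : bialgType F).

Definition dual_eval (a : H) (f : dual H) : F^o := f a.

Lemma dual_eval_is_linear a : linear (dual_eval a).
Proof. by move=> k f f'; rewrite /dual_eval add_lfunE scale_lfunE. Qed.

HB.instance Definition _ a := GRing.isLinear.Build F (dual H) F^o _
  (dual_eval a) (dual_eval_is_linear a).

Lemma dual_tensor_eqP (t t' : tensor (dual H) (dual H)) :
  (forall a b, tensor_eval (dual_eval a) (dual_eval b) t =
               tensor_eval (dual_eval a) (dual_eval b) t') ->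
  t = t'.
Proof.
move=> tt'; apply: tensor_eval_inj => f g.
have [a fa] := @eval_at_onto F H f; have [b gb] := @eval_at_onto F H g.
by rewrite !(eq_tensor_eval fa gb) tt'.
Qed.

(** The map sends a to the form p a. Compatibility of p with products in its second argument says
    that it preserves coproducts; nondegeneracy gives injectivity, and equality of dimensions
    surjectivity. *)
Lemma selfduality_coalg_isom (p : {biscalar H}) :
  selfduality_pairing p -> coalg_isom H (dual H).
Proof.
move=> [[nd _] _ pM _ p1].
pose f (a : H) : dual H := linfun (p a : {linear H -> F^o}).
have fE a b : f a b = p a b by apply: (lfunE (p a : {linear H -> F^o})).
have f_linear : linear f.
  by move=> k a b; apply/lfunP => c; rewrite add_lfunE scale_lfunE !fE linearPl.
pose fL : {linear H -> dual H} := HB.pack f (GRing.isLinear.Build F H (dual H)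
  _ f f_linear).
exists fL; split.
- have ker : lker (linfun fL) == 0%VS.
    apply/eqP/vspaceP => a; rewrite memv_ker memv0 lfunE /=.
    apply/eqP/eqP => [fa0 | ->]; last exact: (linear0 fL).
    by apply: nd => b; rewrite -fE fa0 lfunE.
  have im : limg (linfun fL) = fullv.
    apply/eqP; rewrite eqEdim subvf; have := limg_ker_dim (linfun fL) fullv.
    by rewrite (eqP ker) capv0 dimv0 add0n => ->; rewrite !dimvf;
      apply: eq_leq; apply: muln1.
  exists (linfun fL)^-1%VF => a; first by rewrite -[fL a]lfunE lker0_lfunK.
  by rewrite -[LHS]/(fL _) -(lfunE fL) limg_lfunVK // im memvf.
- move=> c; apply: dual_tensor_eqP => a b.
  rewrite (tensor_eval_tmap fL fL) [LHS](dual_comulE (fL c) a b) fE pM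
    pairing2_tensE.
  by apply: eq_tensor_eval => v; rewrite -fE.
by move=> c; rewrite /counit /= /dual_counit fE p1.
Qed.

End DualCoalgebra.

Section TablePairing.
Variables (F : fieldType) (H : hopfAlgType F) (s x w : H).
Hypotheses (two0 : 2%:R = 0 :> F) (table : hopf_table s x w).
Variable p : {biscalar H}.
Hypothesis p1 : [/\ p 1 1 = 1, p 1 s = 1, p 1 x = 0 & p 1 w = 0].
Hypothesis ps : [/\ p s 1 = 1, p s s = 1, p s x = 1 & p s w = 1].
Hypothesis px : [/\ p x 1 = 0, p x s = 1, p x x = 0 & p x w = 0].
Hypothesis pw : [/\ p w 1 = 0, p w s = 1, p w x = 0 & p w w = 1].

Let ind P := @basis4_ind F H P 1 s x w table.1.

Lemma table_pairing_symmetric a b : p a b = p b a.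
Proof.
have [p11 p1s p1x p1w] := p1; have [ps1 pss psx psw] := ps.
have [px1 pxs pxx pxw] := px; have [pw1 pws pwx pww] := pw.
have V := (p11, p1s, p1x, p1w, ps1, pss, psx, psw, px1, pxs, pxx, pxw, pw1,
  pws, pwx, pww).
elim/ind: a => [k u Pu|u v Pu Pv||||].
- by rewrite linearZl_LR linearZr_LR /= Pu.
- by rewrite linearDl linearDr /= Pu Pv.
all: elim/ind: b => [k u Pu|u v Pu Pv||||];
  [ by rewrite linearZl_LR linearZr_LR /= Pu
  | by rewrite linearDl linearDr /= Pu Pv
  | by rewrite !V .. ].
Qed.

Lemma table_pairing_counit a : p 1 a = counit a.
Proof.
have [_ [_ [_ [[es ex ew] _]]]] := table; have [p11 p1s p1x p1w] := p1.
elim/ind: a => [k u Pu|u v Pu Pv||||]; rewrite ?counit1 ?es ?ex ?ew //.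
  by rewrite linearZr_LR linearZ /= Pu.
by rewrite linearDr linearD /= Pu Pv.
Qed.

Lemma table_pairing_comul a b c : p a (b * c) = pairing2 p (comul a) (tens b c).
Proof.
have add11 : 1 + 1 = 0 :> F := two0.
have [_ [[ss [sx wx ww] xs ws [sw xw xx]] [[Ds Dx Dw] _]]] := table.
have T := (ss, sx, wx, ww, xs, ws, sw, xw, xx, mul1r, mulr1).
have [p11 p1s p1x p1w] := p1; have [ps1 pss psx psw] := ps.
have [px1 pxs pxx pxw] := px; have [pw1 pws pwx pww] := pw.
have V := (p11, p1s, p1x, p1w, ps1, pss, psx, psw, px1, pxs, pxx, pxw, pw1,
  pws, pwx, pww).
elim/ind: a => [k u Pu|u v Pu Pv||||].
- by rewrite linearZl_LR linearZ /= Pu !pairing2_tensE linearZ.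
- by rewrite linearDl linearD /= Pu Pv pairing2Dl.
all: rewrite ?comul1 ?Ds ?Dx ?Dw ?pairing2Dl !pairing2_tens.
all: elim/ind: b => [k u Pu|u v Pu Pv||||];
  [ by rewrite -scalerAl !linearZr_LR /= Pu; ring
  | by rewrite mulrDl !linearDr /= Pu Pv; ring | .. ].
all: elim/ind: c => [k u Pu|u v Pu Pv||||];
  [ by rewrite -scalerAr !linearZr_LR /= Pu; ring
  | by rewrite mulrDr !linearDr /= Pu Pv; ring
  | rewrite !T 2?linearDr /= ?V ?add11; by ring: two0 .. ].
Qed.

Lemma table_pairing_nondegenerate a : (forall b, p a b = 0) -> a = 0.
Proof.
have [p11 p1s p1x p1w] := p1; have [ps1 pss psx psw] := ps.
have [px1 pxs pxx pxw] := px; have [pw1 pws pwx pww] := pw.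
have V := (p11, p1s, p1x, p1w, ps1, pss, psx, psw, px1, pxs, pxx, pxw, pw1,
  pws, pwx, pww).
have [/andP[/eqP aV dX] _] := table.
have dimH : \dim {:H} = 4%N by rewrite -aV (eqP dX).
move=> pa; have [k [l [m [n aE]]]] := span4P dimH dX a.
have E b : k * p 1 b + l * p s b + m * p x b + n * p w b = 0.
  by rewrite -(pa b) aE !linearDl !linearZl_LR.
have l0 : l = 0 by rewrite -(E x) !V; ring.
have n0 : n = 0 by rewrite -(E w) !V l0; ring.
have k0 : k = 0 by rewrite -(E 1) !V l0; ring.
have m0 : m = 0 by rewrite -(E s) !V k0 l0 n0; ring.
by rewrite aE k0 l0 m0 n0 !scale0r !addr0.
Qed.

Lemma table_selfduality : selfduality_pairing p.
Proof.
have pC := table_pairing_symmetric.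
split; [| | exact: table_pairing_comul | exact: table_pairing_counit |].
- split; first exact: table_pairing_nondegenerate.
  by move=> b pb; apply: table_pairing_nondegenerate => a; rewrite pC.
- move=> a b c; rewrite pC (pairing2_symmetric pC); exact: table_pairing_comul.
- by move=> a; rewrite pC; apply: table_pairing_counit.
Qed.

End TablePairing.

(** * The model on the algebra NF *)

Definition H4 : Type := NF.

HB.instance Definition _ := Falgebra.on H4.

(* Solutions in NF of x w = x, w x = w, s x = w and s s = 1. *)
Definition H4s : H4 := (1 + NFy + NFz : NF).
Definition H4x : H4 := NFx.
Definition H4w : H4 := (NFx + NFy : NF).

Section H4.
Notation s := H4s.
Notation x := H4x.
Notation w := H4w.

Lemma H4_mul :
  [/\ s * s = 1,
      [/\ s * x = w, w * x = w & w * w = w],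
      x * s = 1 + s + w,
      w * s = 1 + s + x
    & [/\ s * w = x, x * w = x & x * x = x]].
Proof.
have NF_mod2 (u v : NF) : (forall i, u 0 i = v 0 i) -> u = v by move=> uv;
  apply: NF_eqP.
have [[xx xy xz] [[yx yy yz] [zx zy zz]]] := NF_mul_table.
have T := (mulrDl, mulrDr, mul1r, mulr1, xx, xy, xz, yx, yy, yz, zx, zy, zz,
  addr0, add0r).
pose S : NF := 1 + NFy + NFz; pose W : NF := NFx + NFy.
have H : [/\ S * S = 1,
      [/\ S * NFx = W, W * NFx = W & W * W = W],
      NFx * S = 1 + S + W,
      W * S = 1 + S + NFx
    & [/\ S * W = NFx, NFx * W = NFx & NFx * NFx = NFx]].
  rewrite /S /W !T.
  by split; [| split | | | split]; apply: NF_mod2 => i; rewrite ?NFaddE;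
    ring: F2_two_eq0.
exact: H.
Qed.

Lemma H4_basis : basis_of fullv [:: 1; s; x; w].
Proof.
rewrite basisEdim dimvf leqnn andbT -(span_basis NF_basis); apply/span_subvP.
pose X : seq H4 := [:: 1; s; x; w].
have [s_in x_in w_in one_in] : [/\ s \in <<X>>%VS, x \in <<X>>%VS,
  w \in <<X>>%VS & 1 \in <<X>>%VS].
  by split; apply: memv_span; rewrite !inE eqxx ?orbT.
(* Inverting the definitions of s, x, w recovers the standard basis of NF. *)
have yE : NFy = (w - x : NF) by rewrite /H4w /H4x addrC addKr.
have zE : NFz = (s - 1 - (w - x) : NF).
  by rewrite -yE -addrA -opprD /H4s [X in X - _]addrC addrK.
have y_in : (NFy : H4) \in <<X>>%VS by rewrite yE memvB.
have z_in : (NFz : H4) \in <<X>>%VS by rewrite zE !memvB.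
by move=> v; rewrite !inE => /or4P[] /eqP->.
Qed.

Definition H4_comul_spec := linear_of_basis4 (tens 1 1) (tens s s)
  (tens s x + tens x 1) (tens 1 w + tens w s) H4_basis.

Definition H4_counit_spec := linear_of_basis4 (1 : ('F_2)^o) 1 0 0 H4_basis.

Definition H4_antipode_spec := linear_of_basis4 1 s w (1 + s + x) H4_basis.

Definition H4_comul := sval H4_comul_spec.
Definition H4_counit : {scalar H4} := sval H4_counit_spec.
Definition H4_antipode := sval H4_antipode_spec.

Lemma H4_comulE : [/\ H4_comul 1 = tens 1 1, H4_comul s = tens s s,
  H4_comul x = tens s x + tens x 1 & H4_comul w = tens 1 w + tens w s].
Proof. exact: (svalP H4_comul_spec). Qed.

Lemma H4_counitE : [/\ H4_counit 1 = 1, H4_counit s = 1,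
  H4_counit x = 0 & H4_counit w = 0].
Proof. exact: (svalP H4_counit_spec). Qed.

Lemma H4_antipodeE : [/\ H4_antipode 1 = 1, H4_antipode s = s, H4_antipode x = w
  & H4_antipode w = 1 + s + x].
Proof. exact: (svalP H4_antipode_spec). Qed.

Lemma H4_comulA c : tassoc (tmap H4_comul idfun (H4_comul c)) =
                    tmap idfun H4_comul (H4_comul c).
Proof. by have [D1 Ds Dx Dw] := H4_comulE; apply: (sxw_comulA H4_basis D1 Ds Dx
  Dw). Qed.

Lemma H4_counitl c : tlift (fun a b => H4_counit a *: b) (H4_comul c) = c.
Proof.
have [D1 Ds Dx Dw] := H4_comulE; have [E1 Es Ex Ew] := H4_counitE.
exact: (sxw_counitl H4_basis D1 Ds Dx Dw E1 Es Ex Ew).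
Qed.

Lemma H4_counitr c : tlift (fun a b => H4_counit b *: a) (H4_comul c) = c.
Proof.
have [D1 Ds Dx Dw] := H4_comulE; have [E1 Es Ex Ew] := H4_counitE.
exact: (sxw_counitr H4_basis D1 Ds Dx Dw E1 Es Ex Ew).
Qed.

HB.instance Definition _ := Vector_isCoalgebra.Build 'F_2 H4
  H4_comulA H4_counitl H4_counitr.

Lemma H4_comul1 : comul (1 : H4) = tens 1 1.
Proof. by have [] := H4_comulE. Qed.

Lemma H4_comulM (a b : H4) : comul (a * b) = tmul (comul a) (comul b).
Proof.
have [D1 Ds Dx Dw] := H4_comulE.
exact: (sxw_comulM F2_two_eq0 H4_basis H4_mul D1 Ds Dx Dw).
Qed.

Lemma H4_counit1 : counit (1 : H4) = 1.
Proof. by have [] := H4_counitE. Qed.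

Lemma H4_counitM (a b : H4) : counit (a * b) = counit a * counit b.
Proof.
have [E1 Es Ex Ew] := H4_counitE.
exact: (sxw_counitM F2_two_eq0 H4_basis H4_mul E1 Es Ex Ew).
Qed.

HB.instance Definition _ := Coalgebra_isBialgebra.Build 'F_2 H4
  H4_comul1 H4_comulM H4_counit1 H4_counitM.

Lemma H4_antipodel (a : H4) :
  tlift (fun b c => H4_antipode b * c) (comul a) = (counit a)%:A.
Proof.
have [D1 Ds Dx Dw] := H4_comulE; have [E1 Es Ex Ew] := H4_counitE.
have [S1 Ss Sx Sw] := H4_antipodeE.
exact: (sxw_antipodel F2_two_eq0 H4_basis H4_mul D1 Ds Dx Dw E1 Es Ex Ew S1 Ss
  Sx Sw).
Qed.

Lemma H4_antipoder (a : H4) :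
  tlift (fun b c => b * H4_antipode c) (comul a) = (counit a)%:A.
Proof.
have [D1 Ds Dx Dw] := H4_comulE; have [E1 Es Ex Ew] := H4_counitE.
have [S1 Ss Sx Sw] := H4_antipodeE.
exact: (sxw_antipoder F2_two_eq0 H4_basis H4_mul D1 Ds Dx Dw E1 Es Ex Ew S1 Ss
  Sx Sw).
Qed.

HB.instance Definition _ := Bialgebra_isHopf.Build 'F_2 H4
  H4_antipodel H4_antipoder.

Lemma H4_table : hopf_table s x w.
Proof.
have [D1 Ds Dx Dw] := H4_comulE; have [E1 Es Ex Ew] := H4_counitE.
have [S1 Ss Sx Sw] := H4_antipodeE.
split; first exact: H4_basis.
split; first exact: H4_mul.
split; first exact: And3 Ds Dx Dw.
by split; [exact: And3 Es Ex Ew | exact: And3 Ss Sx Sw].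
Qed.

End H4.

(** * Consequences of the table and conclusion *)

Section TableProperties.
Variables (F : fieldType) (H : hopfAlgType F) (s x w : H).
Hypothesis table : hopf_table s x w.

Lemma table_dim : \dim {:H} = 4%N.
Proof. by have [/andP[/eqP aV /eqP dX] _] := table; rewrite -aV dX. Qed.

Lemma table_noncommutative : noncommutative H.
Proof.
have [/basis_free dX [[_ [sx _ _] xs _ _] _]] := table.
have [f [f1 fs _ fw]] := @dual_of_free4 _ H _ _ _ _ 1 0 0 0 dX.
move=> /(_ x s)/(congr1 f); rewrite xs sx !linearD /= f1 fs fw !addr0.
by move/eqP; rewrite oner_eq0.
Qed.

Lemma table_noncocommutative : noncocommutative H.
Proof.
have [/basis_free dX [_ [[Ds Dx _] _]]] := table.
have [f [f1 fs fx _]] := @dual_of_free4 _ H _ _ _ _ 0 1 0 0 dX.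
have [g [g1 gs gx _]] := @dual_of_free4 _ H _ _ _ _ 0 0 1 0 dX.
move=> /(_ x)/(congr1 (tensor_eval f g)); rewrite Dx !linearD /= !tswap_tens.
rewrite !tensor_evalE /= f1 fs fx g1 gs gx !mulr0 !mul0r mulr1 !addr0.
by move/eqP; rewrite eq_sym oner_eq0.
Qed.

Lemma table_pairing_exists : exists p : {biscalar H},
  [/\ p 1 1 = 1, p 1 s = 1, p 1 x = 0 & p 1 w = 0] /\
  [/\ p s 1 = 1, p s s = 1, p s x = 1 & p s w = 1] /\
  [/\ p x 1 = 0, p x s = 1, p x x = 0 & p x w = 0] /\
  [/\ p w 1 = 0, p w s = 1, p w x = 0 & p w w = 1].
Proof.
have bas := table.1.
have [f1 [f1_1 f1_s f1_x f1_w]] := linear_of_basis4 (1 : F^o) 0 0 0 bas.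
have [fs [fs_1 fs_s fs_x fs_w]] := linear_of_basis4 (0 : F^o) 1 0 0 bas.
have [fx [fx_1 fx_s fx_x fx_w]] := linear_of_basis4 (0 : F^o) 0 1 0 bas.
have [fw [fw_1 fw_s fw_x fw_w]] := linear_of_basis4 (0 : F^o) 0 0 1 bas.
have [g1 [g1_1 g1_s g1_x g1_w]] := linear_of_basis4 (1 : F^o) 1 0 0 bas.
have [gs [gs_1 gs_s gs_x gs_w]] := linear_of_basis4 (1 : F^o) 1 1 1 bas.
have [gx [gx_1 gx_s gx_x gx_w]] := linear_of_basis4 (0 : F^o) 1 0 0 bas.
have [gw [gw_1 gw_s gw_x gw_w]] := linear_of_basis4 (0 : F^o) 1 0 1 bas.
(* The f's are the coordinate forms of the basis, and the g's are the rows of the prescribed Gram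
   matrix. *)
pose p0 a b : F := f1 a * g1 b + fs a * gs b + fx a * gx b + fw a * gw b.
have p0_bilinear : bilinear_for *%R *%R p0.
  split=> [b | a] k u v; rewrite /p0 !linearP /=; rewrite /GRing.scale /=; ring.
pose p : {biscalar H} := HB.pack p0 (bilinear_isBilinear.Build F H H F *%R *%R
  p0 p0_bilinear).
have V := (f1_1, f1_s, f1_x, f1_w, fs_1, fs_s, fs_x, fs_w, fx_1, fx_s, fx_x,
  fx_w, fw_1, fw_s, fw_x, fw_w, g1_1, g1_s, g1_x, g1_w, gs_1, gs_s, gs_x, gs_w,
    gx_1, gx_s, gx_x, gx_w, gw_1, gw_s, gw_x, gw_w).
exists p; split; [|split; [|split]]; split; rewrite /p /= /p0 !V; ring.
Qed.

End TableProperties.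

Theorem proposition4p2 :
  exists H : hopfAlgType 'F_2,
    [/\ \dim {:H} = 4%N, noncommutative H & noncocommutative H] /\
    (forall K : hopfAlgType 'F_2,
       \dim {:K} = 4%N -> noncommutative K -> noncocommutative K ->
       hopf_isom K H) /\
    type_NF_NFdual H /\
    exists s x w : H,
      basis_of fullv [:: 1; s; x; w] /\
      [/\ s * s = 1,
          [/\ s * x = w, w * x = w & w * w = w],
          x * s = 1 + s + w,
          w * s = 1 + s + x
        & [/\ s * w = x, x * w = x & x * x = x]] /\
      [/\ comul s = tens s s,
          comul x = tens s x + tens x 1
        & comul w = tens 1 w + tens w s] /\
      [/\ counit s = 1, counit x = 0 & counit w = 0] /\
      [/\ antipode s = s, antipode x = w & antipode w = 1 + s + x] /\
      exists p : {biscalar H},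
        selfduality_pairing p /\
        [/\ p 1 1 = 1, p 1 s = 1, p 1 x = 0 & p 1 w = 0] /\
        [/\ p s 1 = 1, p s s = 1, p s x = 1 & p s w = 1] /\
        [/\ p x 1 = 0, p x s = 1, p x x = 0 & p x w = 0] /\
        [/\ p w 1 = 0, p w s = 1, p w x = 0 & p w w = 1].
Proof.
have table := H4_table; have [p [p1 [ps [px pw]]]]
  := table_pairing_exists table.
have pP := table_selfduality F2_two_eq0 table p1 ps px pw.
exists (H4 : hopfAlgType 'F_2); split.
  by split; [exact: (table_dim table) | exact: (table_noncommutative table) |
    exact: (table_noncocommutative table)].
split.
  move=> K dimK ncK nccK; have [s [x [w tableK]]]
    := hopf_table_exists dimK ncK nccK.
  exact: hopf_isom_of_table tableK table.
split.
  (* As an algebra [H4] is NF itself, so the identity settles the algebra type, and self-duality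
     identifies the coalgebra with the dual of NF. *)
  split; last exact: selfduality_coalg_isom pP.
  exists (idfun : {lrmorphism NF -> NF}); exact: (Bijective (fun=> erefl)
    (fun=> erefl)).
exists H4s, H4x, H4w; have [bas [mul [com [cou ant]]]] := table.
do 5!split=> //.
exists p; split; first exact: pP.
by split; [|split; [|split]].
Qed.
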